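(* Let $\mathcal{O}_q(G/L_S)$ be an irreducible quantum flag manifold and consider the quantum principal $\mathcal{O}(U_1)$-bundle with total space $P=\mathcal{O}_q(G/L_S^{\mathrm{s}})$, base $\mathcal{O}_q(G/L_S)$ and calculus $\Omega^{(0,1)}_q(G/L_S^{\mathrm{s}})$. Then the zero map $\Omega^{(0,1)}_q(G/L_S^{\mathrm{s}})\to\Omega^{(0,1)}_q(G/L_S^{\mathrm{s}})$ is a left $\mathcal{O}_q(G)$-covariant strong principal connection.
   Context: Quantum groups. Let $\mathfrak{g}$ be a finite-dimensional complex simple Lie algebra of rank $l$ with Cartan subalgebra $\mathfrak{h}$, simple roots $\Pi=\{\alpha_1,\dots,\alpha_l\}$, positive roots $R^+$, Weyl group with longest element $w_0$, and form $(\cdot,\cdot)$ on $\mathfrak{h}^*$ normalised so that shortest simple roots satisfy $(\alpha_i,\alpha_i)=2$. Put $\alpha_i^\vee=2\alpha_i/(\alpha_i,\alpha_i)$, $a_{ij}=(\alpha_i^\vee,\alpha_j)$; let $\varpi_1,\dots,\varpi_l$ be the fundamental weights and $\mathcal{P}^+$ the dominant integral weights. Fix $q\in\mathbb{R}\setminus\{-1,0,1\}$ and $q_i=q^{(\alpha_i,\alpha_i)/2}$. $U_q(\mathfrak{g})$ is the Hopf algebra generated by $E_i,F_i,K_i^{\pm1}$ with $K_iK_j=K_jK_i$, $K_iE_j=q_i^{a_{ij}}E_jK_i$, $K_iF_j=q_i^{-a_{ij}}F_jK_i$, $E_iF_j-F_jE_i=\delta_{ij}(K_i-K_i^{-1})/(q_i-q_i^{-1})$,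 the quantum Serre relations, $\Delta(K_i)=K_i\otimes K_i$, $\Delta(E_i)=E_i\otimes K_i+1\otimes E_i$, $\Delta(F_i)=F_i\otimes1+K_i^{-1}\otimes F_i$, $\varepsilon(E_i)=\varepsilon(F_i)=0$, $\varepsilon(K_i)=1$. For $\lambda\in\mathcal{P}^+$, $V_\lambda$ is the finite-dimensional irreducible (type-1) left module generated by a vector $v$ with $E_iv=0$ and $K_iv=q^{(\alpha_i,\lambda)}v$ for all $i$. For $v\in V_\lambda$, $f\in V_\lambda^*$ set $c^{\lambda}_{f,v}(X)=f(Xv)$, $X\in U_q(\mathfrak{g})$. $\mathcal{O}_q(G)\subseteq U_q(\mathfrak{g})^\circ$ is the Hopf subalgebra spanned by all $c^{\lambda}_{f,v}$, $\lambda\in\mathcal{P}^+$. It carries the left action $X\triangleright a=a_{(1)}a_{(2)}(X)$ and the right action $a\triangleleft X=a_{(1)}(X)a_{(2)}$ of $U_q(\mathfrak{g})$. Irreducible quantum flag manifolds. For $S\subseteq\Pi$, $U_q(\mathfrak{l}_S)$ is the subalgebra generated by all $K_i^{\pm1}$ and by $E_j,F_j$ for $\alpha_j\in S$; $U_q(\mathfrak{l}_S^{\mathrm{s}})$ is the subalgebra generated by $K_j^{\pm1},E_j,F_j$ for $\alpha_j\in S$. Set $\mathcal{O}_q(G/L_S)=\{b\in\mathcal{O}_q(G): X\triangleright b=\varepsilon(X)b\ \forall X\in U_q(\mathfrak{l}_S)\}$ and $\mathcal{O}_q(G/L_S^{\mathrm{s}})=\{b: X\triangleright b=\varepsilon(X)b\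 \forall X\in U_q(\mathfrak{l}_S^{\mathrm{s}})\}$. The quantum flag manifold is irreducible when $S=\Pi\setminus\{\alpha_x\}$ with $\alpha_x$ of coefficient $1$ in the highest root (up to diagram automorphism: any node of $A_n$; the first node of $B_n$; the last node of $C_n$; the first node or a spin node of $D_n$; an end node of a long leg of $E_6$; the end node $7$ of $E_7$). Generators and $\mathcal{O}(U_1)$-coaction. Let $N=\dim V_{\varpi_x}$, let $v_1,\dots,v_N$ be a weight basis of $V_{\varpi_x}$ with $v_N$ a highest weight vector, and $f_1,\dots,f_N$ the dual basis of $V_{\varpi_x}^*\cong V_{-w_0(\varpi_x)}$ (left action $(Xf)(v)=f(S(X)v)$). Then $z_i=c^{\varpi_x}_{f_i,v_N}$ and $\overline{z}_j=c^{-w_0(\varpi_x)}_{v_j,f_N}$ generate $P=\mathcal{O}_q(G/L_S^{\mathrm{s}})$, which has a $\mathbb{Z}$-algebra grading with $\deg z_i=1$, $\deg\overline{z}_j=-1$ and degree zero part $\mathcal{O}_q(G/L_S)$. Equivalently $P$ is a right comodule algebra over the Hopf algebra $\mathcal{O}(U_1)=\mathbb{C}[t,t^{-1}]$ ($t$ grouplike) via $p\mapsto p\otimes t^{k}$ for $p$ of degree $k$; its coinvariants are $\mathcal{O}_q(G/L_S)$. Let $S_q[G/L_S]\subseteq P$ be the subalgebra generated by the $z_i$. Calculi. A first-order differential calculus (fodc) over an algebra $B$ is a $B$-bimodule $\Omega^1$ with a derivation $\mathrm{d}:B\to\Omega^1$ such that $\Omega^1$ is generated as a left module by $\mathrm{d}B$.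 Its restriction to a subalgebra $B'$ is the fodc over $B'$ generated inside $\Omega^1$ by the $\mathrm{d}b$, $b\in B'$. A fodc over a right $H$-comodule algebra $P$ is right $H$-covariant if $p\,\mathrm{d}p'\mapsto p_{(0)}\mathrm{d}p'_{(0)}\otimes p_{(1)}p'_{(1)}$ is well defined; left covariance is analogous. The $(0,1)$-calculus over $B=\mathcal{O}_q(G/L_S)$. Let $B^+=\ker(\varepsilon|_B)$, $K=U_q(\mathfrak{l}_S)$. Let $T^{(0,1)}$ be the span of the functionals on $B$ given by the Lusztig quantum root vectors $E_\beta$, $\beta\in R^+\setminus\mathbb{Z}S$, the underlying reduced decomposition of $w_0$ being such that $T^{(0,1)}$ is stable under left multiplication by $K$; explicitly, $T^{(0,1)}$ is the space of functionals induced by $U_q(\mathfrak{l}_S)E_x$. Put $I=\{b\in B^+: X(b)=0\ \forall X\in T^{(0,1)}\}$ and $V=B^+/I$, a right $B$-module and a right $K$-module via $\triangleleft$. Then $\Omega^{(0,1)}_q(G/L_S)$ consists of the $\sum_i a_i\otimes v_i\in\mathcal{O}_q(G)\otimes V$ with $\sum_i(Y\triangleright a_i)\otimes v_i=\sum_i a_i\otimes(v_i\triangleleft Y)$ for all $Y\in K$, with left $B$-action on the first factor, right action $(a\otimes v)b=ab_{(1)}\otimes vb_{(2)}$, left $\mathcal{O}_q(G)$-coaction on the first factor, and $\overline{\partial}b=b_{(1)}\otimes[b_{(2)}-\varepsilon(b_{(2)})1]$. The $(0,1)$-calculus over $P$. $(\Omega^{(0,1)}_q(G/L_S^{\mathrm{s}}),\overline{\partial})$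 is the fodc over $P$ constructed by Heckenberger and Kolb; it is the unique left $\mathcal{O}_q(G)$-covariant fodc over $P$ such that $\overline{\partial}f=0$ for all $f\in S_q[G/L_S]$ and whose restriction to $\mathcal{O}_q(G/L_S)$ is $\Omega^{(0,1)}_q(G/L_S)$. It is right $\mathcal{O}(U_1)$-covariant and makes $P$ a quantum principal $\mathcal{O}(U_1)$-bundle over $B$. Principal connections. For a quantum principal $H$-bundle $(P,\Omega^1(P))$ with base $B=P^{\mathrm{co}(H)}$ and $\Omega^1(B)$ the restriction of $\Omega^1(P)$ to $B$, a principal connection is a left $P$-module, right $H$-comodule projection $\Pi:\Omega^1(P)\to\Omega^1(P)$ with $\ker(\Pi)=P\Omega^1(B)P$. It is strong if $(\mathrm{id}-\Pi)(\mathrm{d}P)\subseteq\Omega^1(B)P$. Left $\mathcal{O}_q(G)$-covariant means that $\Pi$ is a left $\mathcal{O}_q(G)$-comodule map. *)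

(* Defs.v *)
Set Warnings "-notation-overridden,-notation-incompatible-prefix,-ambiguous-paths,-redundant-canonical-projection,-deprecated,-projection-no-head-constant".
From HB Require Import structures.
From mathcomp Require Import all_boot all_order all_algebra generic_quotient finmap.
From mathcomp Require Import boolp classical_sets functions reals complex monalg.

Set Implicit Arguments.
Unset Strict Implicit.
Unset Printing Implicit Defensive.

Import Order.TTheory GRing.Theory Num.Theory.
Local Open Scope classical_set_scope.
Local Open Scope quotient_scope.
Local Open Scope ring_scope.

Section LinearSpan.
Variables (k : fieldType) (V : lmodType k).

Inductive lspan (X : set V) : set V :=
| lspan_zero : lspan X 0
| lspan_cons c x v of X x & lspan X v : lspan X (c *: x + v).

Lemma lspan_lin X c u v : lspan X u -> lspan X v -> lspan X (c *: u + v).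
Proof.
move=> Xu Xv; elim: Xu => [|e x w Xx _ IH]; first by rewrite scaler0 add0r.
by rewrite scalerDr scalerA -addrA; apply: lspan_cons.
Qed.

Lemma lspanZ X c u : lspan X u -> lspan X (c *: u).
Proof. by move=> Xu; rewrite -[_ *: _]addr0; apply: lspan_lin => //; left. Qed.

Lemma lspanD X u v : lspan X u -> lspan X v -> lspan X (u + v).
Proof. by move=> Xu Xv; rewrite -[u]scale1r; apply: lspan_lin. Qed.

Lemma lspanN X u : lspan X u -> lspan X (- u).
Proof. by rewrite -scaleN1r; apply: lspanZ. Qed.

Lemma lspan_mem X u : X u -> lspan X u.
Proof. by move=> Xu; rewrite -[u]scale1r -[_ *: _]addr0; apply: lspan_cons => //; left. Qed.

End LinearSpan.

Section QuotientSpace.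
Variables (k : fieldType) (V : lmodType k) (X : set V).

Definition lquot_rel : rel V := fun u v => `[< lspan X (u - v) >].

Lemma lquot_rel_equiv : equiv_class_of lquot_rel.
Proof.
split=> [u|u v|v u w].
- by apply/asboolP; rewrite subrr; left.
- by apply/idP/idP => /asboolP/lspanN; rewrite opprB => /asboolP.
- move=> /asboolP Huv /asboolP Hvw; apply/asboolP.
  by rewrite -(subrKA v); apply: lspanD.
Qed.

Canonical lquot_rel_equiv_rel := EquivRelPack lquot_rel_equiv.
Canonical lquot_rel_encModRel := defaultEncModRel lquot_rel.

Definition lquot := {eq_quot lquot_rel}.
HB.instance Definition _ := Choice.on lquot.
HB.instance Definition _ : EqQuotient V lquot_rel lquot := EqQuotient.on lquot.

Lemma lquot_eqP (u v : V) : reflect (lspan X (u - v)) (u == v %[mod lquot]).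
Proof. by rewrite piE; apply: (iffP idP) => /asboolP. Qed.

Definition lquot_add (x y : lquot) : lquot := \pi_lquot (repr x + repr y).
Definition lquot_opp (x : lquot) : lquot := \pi_lquot (- repr x).
Definition lquot_scale c (x : lquot) : lquot := \pi_lquot (c *: repr x).

Lemma lquot_repr u : lspan X (repr (\pi_lquot u) - u).
Proof. by apply/lquot_eqP; rewrite reprK. Qed.

Lemma lquot_pi_add u v : lquot_add (\pi_lquot u) (\pi_lquot v) = \pi_lquot (u + v).
Proof.
apply/eqP/lquot_eqP; rewrite opprD addrACA.
by apply: lspanD; exact: lquot_repr.
Qed.

Lemma lquot_pi_opp u : lquot_opp (\pi_lquot u) = \pi_lquot (- u).
Proof. by apply/eqP/lquot_eqP; rewrite -opprD; apply/lspanN/lquot_repr. Qed.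

Lemma lquot_pi_scale c u : lquot_scale c (\pi_lquot u) = \pi_lquot (c *: u).
Proof. by apply/eqP/lquot_eqP; rewrite -scalerBr; apply/lspanZ/lquot_repr. Qed.

Lemma lquot_ind (P : lquot -> Prop) : (forall u, P (\pi_lquot u)) -> forall x, P x.
Proof. by move=> HP x; rewrite -[x]reprK. Qed.

Fact lquot_addA : associative lquot_add.
Proof.
by do 3!elim/lquot_ind=> ?; rewrite !lquot_pi_add addrA.
Qed.
Fact lquot_addC : commutative lquot_add.
Proof. by do 2!elim/lquot_ind=> ?; rewrite !lquot_pi_add addrC. Qed.
Fact lquot_add0 : left_id (\pi_lquot 0) lquot_add.
Proof. by elim/lquot_ind=> ?; rewrite !lquot_pi_add add0r. Qed.
Fact lquot_addN : left_inverse (\pi_lquot 0) lquot_opp lquot_add.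
Proof. by elim/lquot_ind=> ?; rewrite lquot_pi_opp lquot_pi_add addNr. Qed.

HB.instance Definition _ := GRing.isZmodule.Build lquot
  lquot_addA lquot_addC lquot_add0 lquot_addN.

Fact lquot_scaleA a b (v : lquot) :
  lquot_scale a (lquot_scale b v) = lquot_scale (a * b) v.
Proof. by elim/lquot_ind: v => v; rewrite !lquot_pi_scale scalerA. Qed.
Fact lquot_scale1 : left_id 1 lquot_scale.
Proof. by elim/lquot_ind=> ?; rewrite !lquot_pi_scale scale1r. Qed.
Fact lquot_scaleDr : right_distributive lquot_scale +%R.
Proof.
move=> a; do 2!elim/lquot_ind=> ?.
by rewrite /GRing.add /= !(lquot_pi_scale, lquot_pi_add) scalerDr.
Qed.
Fact lquot_scaleDl v : {morph lquot_scale^~ v : a b / a + b}.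
Proof.
move=> a b; elim/lquot_ind: v => v.
by rewrite [in RHS]/GRing.add /= !(lquot_pi_scale, lquot_pi_add) scalerDl.
Qed.

HB.instance Definition _ := GRing.Zmodule_isLmodule.Build k lquot
  lquot_scaleA lquot_scale1 lquot_scaleDr lquot_scaleDl.

Definition lproj (u : V) : lquot := \pi_lquot u.

Lemma lproj_is_linear : linear lproj.
Proof. by move=> c u v; rewrite /lproj -lquot_pi_add -lquot_pi_scale. Qed.

HB.instance Definition _ := GRing.isLinear.Build k V lquot _ lproj lproj_is_linear.

End QuotientSpace.

Inductive tens_rels (k : fieldType) (A M : lmodType k) :
  set {malg k[(A * M)%type]} :=
| tens_relDl a a' m :
    tens_rels (<< (a + a', m) >> - << (a, m) >> - << (a', m) >>)
| tens_relDr a m m' :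
    tens_rels (<< (a, m + m') >> - << (a, m) >> - << (a, m') >>)
| tens_relZl c a m : tens_rels (<< (c *: a, m) >> - c *: << (a, m) >>)
| tens_relZr c a m : tens_rels (<< (a, c *: m) >> - c *: << (a, m) >>).

Definition tens (k : fieldType) (A M : lmodType k) : Type :=
  lquot (@tens_rels k A M).
HB.instance Definition _ (k : fieldType) (A M : lmodType k) :=
  GRing.Lmodule.on (tens A M).

HB.lock Definition tpure (k : fieldType) (A M : lmodType k) (a : A) (m : M) :
  tens A M := lproj (@tens_rels k A M) << (a, m) >>.

Definition bilin (k : fieldType) (A M W : lmodType k) (f : A -> M -> W) :=
  (forall m, linear (f^~ m)) /\ (forall a, linear (f a)).

(* The linear map on the tensor product induced by [f]; it is only meaningful
   when [f] is bilinear. *)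
HB.lock Definition tlift (k : fieldType) (A M W : lmodType k)
  (f : A -> M -> W) (t : tens A M) : W :=
  let r := repr t in \sum_(p <- msupp r) r@_p *: f p.1 p.2.

Section TensorProduct.
Variable k : fieldType.

Section Lift.
Variables (A M W : lmodType k) (f : A -> M -> W).

Definition mlift (r : {malg k[(A * M)%type]}) : W :=
  \sum_(p <- msupp r) r@_p *: f p.1 p.2.

Lemma mliftEw r (D : {fset A * M}) : (msupp r `<=` D)%fset ->
  mlift r = \sum_(p <- D) r@_p *: f p.1 p.2.
Proof.
move=> sD; rewrite /mlift [RHS](bigID (mem (msupp r))) /= [X in _ + X]big1; last first.
  by move=> p /mcoeff_outdom ->; rewrite scale0r.
rewrite addr0 -[RHS]big_filter; apply: perm_big; apply: uniq_perm.
- exact: fset_uniq.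
- exact/filter_uniq/fset_uniq.
by move=> p; rewrite mem_filter; case: (boolP (p \in _)) => //= /(fsubsetP sD).
Qed.

Lemma mlift_linear : linear mlift.
Proof.
move=> c r s; pose D := (msupp (c *: r + s) `|` (msupp r `|` msupp s))%fset.
rewrite !(@mliftEw _ D).
- rewrite scaler_sumr -big_split /=; apply: eq_bigr => p _.
  by rewrite mcoeffD mcoeffZ scalerDl scalerA.
- by rewrite /D fsetUA fsubsetUr.
- by rewrite /D fsetUCA fsubsetUl.
- by rewrite /D fsubsetUl.
Qed.
HB.instance Definition _ := GRing.isLinear.Build k _ W _ mlift mlift_linear.

Lemma mliftU a m : mlift << (a, m) >> = f a m.
Proof.
rewrite (@mliftEw _ [fset (a, m)]%fset); first by rewrite big_seq_fset1 mcoeffUU scale1r.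
apply/fsubsetP => p; rewrite -mcoeff_neq0 mcoeffU in_fset1 [p == _]eq_sym; by case: (_ == p); rewrite ?eqxx.
Qed.

Hypothesis bf : bilin f.

Lemma mlift_rels r : lspan (@tens_rels k A M) r -> mlift r = 0.
Proof.
have fDl a a' m : f (a + a') m = f a m + f a' m.
  by have /= := bf.1 m 1 a a'; rewrite !scale1r.
have fDr a m m' : f a (m + m') = f a m + f a m'.
  by have /= := bf.2 a 1 m m'; rewrite !scale1r.
have f0l m : f 0 m = 0.
  by apply: (addIr (f 0 m)); rewrite -fDl addr0 add0r.
have f0r a : f a 0 = 0.
  by apply: (addIr (f a 0)); rewrite -fDr addr0 add0r.
have fZl c a m : f (c *: a) m = c *: f a m.
  by have /= := bf.1 m c a 0; rewrite f0l !addr0.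
have fZr c a m : f a (c *: m) = c *: f a m.
  by have /= := bf.2 a c m 0; rewrite f0r !addr0.
have mliftZ c s : mlift (c *: s) = c *: mlift s by rewrite linearZ.
elim=> [|c x v rx _ IH]; first by rewrite linear0.
rewrite mlift_linear IH addr0; case: rx => [a a' m|a m m'|e a m|e a m].
- by rewrite !linearB /= !mliftU fDl -!scalerBr addrAC addrK subrr ?scaler0.
- by rewrite !linearB /= !mliftU fDr -!scalerBr addrAC addrK subrr ?scaler0.
- by rewrite !linearB /= !mliftZ !mliftU fZl subrr ?scaler0.
- by rewrite !linearB /= !mliftZ !mliftU fZr subrr ?scaler0.
Qed.

Lemma tlift_pi r : tlift f (lproj (@tens_rels k A M) r) = mlift r.
Proof.
have -> : tlift f (lproj (@tens_rels k A M) r) =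
    mlift (repr (lproj (@tens_rels k A M) r)) by rewrite tlift.unlock.
by apply/eqP; rewrite -subr_eq0 -linearB /= mlift_rels //; exact: lquot_repr.
Qed.

Lemma tliftE a m : tlift f (tpure a m) = f a m.
Proof. by rewrite tpure.unlock tlift_pi mliftU. Qed.

Lemma tlift_linear : linear (tlift f).
Proof.
move=> c; do 2!elim/lquot_ind=> ?; rewrite -!/(lproj (@tens_rels k _ _) _) -linearP.
by rewrite !tlift_pi linearP.
Qed.
End Lift.

Lemma tpure_bilin (A M : lmodType k) : bilin (@tpure k A M).
Proof.
have eq_rel (x y : {malg k[(A * M)%type]}) : @tens_rels k A M (x - y) ->
    lproj (@tens_rels k A M) x = lproj (@tens_rels k A M) y.
  by move=> xy; apply/eqP/lquot_eqP/lspan_mem.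
have tD x y z : @tens_rels k A M (x - y - z) ->
    lproj (@tens_rels k A M) x = lproj (@tens_rels k A M) y + lproj (@tens_rels k A M) z.
  by move=> xyz; rewrite -linearD; apply: eq_rel; rewrite opprD addrA.
have tZ c x y : @tens_rels k A M (x - c *: y) ->
    lproj (@tens_rels k A M) x = c *: lproj (@tens_rels k A M) y.
  by move=> xy; rewrite -linearZ; apply: eq_rel.
split=> [m c a a'|a c m m']; rewrite tpure.unlock.
  by rewrite (tD _ _ _ (tens_relDl _ _ _)) (tZ _ _ _ (tens_relZl _ _ _)).
by rewrite (tD _ _ _ (tens_relDr _ _ _)) (tZ _ _ _ (tens_relZr _ _ _)).
Qed.

Lemma tens_ind (A M : lmodType k) (P : tens A M -> Prop) :
  P 0 -> (forall a m t, P t -> P (tpure a m + t)) -> forall t, P t.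
Proof.
have tpure0 (m : M) : tpure 0 m = 0 :> tens A M.
  by have := (tpure_bilin A M).1 m (-1) 0 0; rewrite !scaleN1r oppr0 addr0 addNr.
have tpureE (a : A) (m : M) : lproj (@tens_rels k A M) << (a, m) >> = tpure a m.
  by rewrite tpure.unlock.
have tpureZ (c : k) (a : A) (m : M) : c *: tpure a m = tpure (c *: a) m.
  by have := (tpure_bilin A M).1 m c a 0; rewrite !addr0 tpure0 addr0.
move=> P0 PD; elim/lquot_ind=> r; rewrite (monalgE r) -/(lproj _ _) linear_sum.
elim: (enum_fset _) => [|[a m] s IH]; first by rewrite big_nil.
rewrite big_cons; have -> : << r@_(a, m) *g (a, m) >> = r@_(a, m) *: << (a, m) >>.
  by apply/malgP => p; rewrite mcoeffZ !mcoeffU mulr_natr.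
by rewrite linearZ /= tpureE tpureZ; apply: PD.
Qed.

Lemma linear_comb (V W : lmodType k) (c : k) (u v : V -> W) :
  linear u -> linear v -> linear (fun t => c *: u t + v t).
Proof.
move=> lu lv d s t; rewrite lu lv !scalerDr !scalerA.
by rewrite addrACA [c * d]mulrC.
Qed.

Lemma linear_comp (V V' W : lmodType k) (f : V -> V') (g : V' -> W) :
  linear f -> linear g -> linear (fun t => g (f t)).
Proof. by move=> lf lg c s t; rewrite lf lg. Qed.

Lemma tlift_ext (A M W : lmodType k) (f g : tens A M -> W) : linear f -> linear g ->
  (forall a m, f (tpure a m) = g (tpure a m)) -> f =1 g.
Proof.
move=> lf lg fg.
have f0 : f 0 = 0 by have := lf (-1) 0 0; rewrite !scaleN1r oppr0 addr0 addNr.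
have g0 : g 0 = 0 by have := lg (-1) 0 0; rewrite !scaleN1r oppr0 addr0 addNr.
elim/tens_ind=> [|a m t IH]; first by rewrite f0 g0.
by rewrite -[tpure a m]scale1r lf lg fg IH.
Qed.

(* f (x) g for linear maps f and g *)
Definition tmap (A M A' M' : lmodType k) (f : A -> A') (g : M -> M') :
  tens A M -> tens A' M' := tlift (fun a m => tpure (f a) (g m)).

End TensorProduct.

Arguments tmap {k A M A' M'}.

Section HopfAlgebra.
Variable k : fieldType.

Definition tens_mul (A B : algType k) (s t : tens A B) : tens A B :=
  tlift (fun a b => tlift (fun a' b' => tpure (a * a') (b * b')) t) s.

Record hopf := Hopf {
  hopf_car :> algType k;
  comul : {linear hopf_car -> tens hopf_car hopf_car};
  counit : {linear hopf_car -> k^o};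
  antipode : {linear hopf_car -> hopf_car};
  comulA : forall X,
    tlift (fun a b => tlift (fun a1 a2 => tpure a1 (tpure a2 b)) (comul a)) (comul X)
      = tmap idfun comul (comul X) :> tens hopf_car (tens hopf_car hopf_car);
  counitl : forall X, tlift (fun a b => counit a *: b) (comul X) = X;
  counitr : forall X, tlift (fun a b => counit b *: a) (comul X) = X;
  comul1 : comul 1 = tpure 1 1;
  comulM : forall X Y, comul (X * Y) = tens_mul (comul X) (comul Y);
  counit1 : counit 1 = 1;
  counitM : forall X Y, counit (X * Y) = counit X * counit Y;
  antipodel : forall X, tlift (fun a b => antipode a * b) (comul X) = counit X *: 1;
  antipoder : forall X, tlift (fun a b => a * antipode b) (comul X) = counit X *: 1
}.

End HopfAlgebra.

Arguments comul {k h}.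
Arguments counit {k h}.
Arguments antipode {k h}.

Section Dual.
Variables (k : fieldType) (U : hopf k).

Definition is_lfun : {pred U -> k^o} := fun f => `[< linear f >].

Lemma is_lfun_submod : submod_closed is_lfun.
Proof.
have f0 u : (0 : U -> k^o) u = 0 by [].
have fP (c : k) (f g : U -> k^o) u : (c *: f + g) u = c *: f u + g u by [].
split=> [|c f g /asboolP lf /asboolP lg]; apply/asboolP => d x y.
  by rewrite !f0 scaler0 addr0.
by rewrite !fP lf lg !scalerDr !scalerA mulrC addrACA.
Qed.
HB.instance Definition _ := GRing.isSubmodClosed.Build k (U -> k^o) is_lfun is_lfun_submod.

(* U^*, all linear functionals, with the convolution product; the finite dual is a
   subalgebra of it *)
Record dual := Dual { dual_fun :> U -> k^o; dual_subproof : is_lfun dual_fun }.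
HB.instance Definition _ := [isSub for dual_fun].
HB.instance Definition _ := [Choice of dual by <:].
HB.instance Definition _ := [SubChoice_isSubLmodule of dual by <:].


Lemma dual_linear (f : dual) : linear f.
Proof. exact/asboolP/dual_subproof. Qed.
HB.instance Definition _ (f : dual) := GRing.isLinear.Build k U k^o _ f (dual_linear f).

Lemma dualP (f g : dual) : (forall X, f X = g X) -> f = g.
Proof. by move=> fg; apply/val_inj/funext. Qed.

Lemma dualDE (f g : dual) X : (f + g) X = f X + g X. Proof. by []. Qed.
Lemma dualZE c (f : dual) X : (c *: f) X = c * f X. Proof. by []. Qed.

Definition mkdual (f : U -> k^o) (lf : linear f) : dual := Dual (asboolT lf).

Definition dual_tensor (f g : U -> k^o) (a b : U) : k^o := f a * g b.

Lemma dual_tensor_bilin (f g : dual) : bilin (dual_tensor f g).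
Proof.
split=> [b c a a'|a c b b']; rewrite /dual_tensor linearP.
  by rewrite mulrDl -scalerAl.
by rewrite mulrDr -scalerAr.
Qed.

Lemma conv_subproof (f g : dual) :
  linear (fun X => tlift (dual_tensor f g) (comul X) : k^o).
Proof.
by move=> c X Y; rewrite linearP tlift_linear //; exact: dual_tensor_bilin.
Qed.

Definition conv f g := mkdual (conv_subproof f g).
Definition dual_one := mkdual (linearP (@counit k U)).


Lemma convA : associative conv.
Proof.
move=> f g h; apply: dualP => X /=.
pose F (a : U) (t : tens U U) : k^o := f a * tlift (dual_tensor g h) t.
have bF : bilin F.
  split=> [t c a a'|a c t t']; rewrite /F.
    by rewrite linearP mulrDl -scalerAl.
  by rewrite (tlift_linear (dual_tensor_bilin _ _)) mulrDr -scalerAr.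
have bp (A M : lmodType k) := tpure_bilin A M.
have b1 : bilin (fun a b => tpure (idfun a) (comul b) : tens U (tens U U)).
  split=> [b c a a'|a c b b'] /=; first exact: (bp _ _).1.
  by rewrite linearP; exact: (bp _ _).2.
have b3 (b : U) : bilin (fun a1 a2 : U => tpure a1 (tpure a2 b)).
  split=> [a2 c a a'|a c a2 a2'] /=; first exact: (bp _ _).1.
  by rewrite (bp _ _).1 (bp _ _).2.
have b2 : bilin (fun a b : U =>
    tlift (fun a1 a2 => tpure a1 (tpure a2 b)) (comul a)).
  split=> [b c a a'|a c b b'] /=; first by rewrite linearP (tlift_linear (b3 b)).
  move: (comul a); apply: tlift_ext => [||a1 a2]; first exact: tlift_linear (b3 _).
    exact: linear_comb (tlift_linear (b3 b)) (tlift_linear (b3 b')).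
  have T0 := tliftE (b3 (c *: b + b')) a1 a2.
  have T1 := tliftE (b3 b) a1 a2.
  rewrite T0.
 rewrite T1.
  rewrite (tliftE (b3 b') a1 a2).
  by rewrite (bp _ _).2 (bp _ _).2.
have bl : bilin (dual_tensor f (conv g h)) := dual_tensor_bilin f (conv g h).
have br : bilin (dual_tensor (conv f g) h) := dual_tensor_bilin (conv f g) h.
have bfg := dual_tensor_bilin f g; have bgh := dual_tensor_bilin g h.
transitivity (tlift F (tmap idfun comul (comul X))).
  move: (comul X); apply: tlift_ext => [||a b].
  - exact: tlift_linear bl.
  - exact: linear_comp (tlift_linear b1) (tlift_linear bF).
  by rewrite (tliftE bl) /tmap (tliftE b1) (tliftE bF).
rewrite -comulA; move: (comul X); apply: tlift_ext => [||a b].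
- exact: linear_comp (tlift_linear b2) (tlift_linear bF).
- exact: tlift_linear br.
rewrite (tliftE b2) (tliftE br) /dual_tensor /=.
move: (comul a); apply: tlift_ext => [||a1 a2].
- exact: linear_comp (tlift_linear (b3 b)) (tlift_linear bF).
- move=> c s t; rewrite (tlift_linear bfg) mulrDl.
  by rewrite -scalerAl.
rewrite (tliftE (b3 b)) (tliftE bF) /F (tliftE bfg) (tliftE bgh).
by rewrite /dual_tensor mulrA.
Qed.

Lemma convDl : left_distributive conv +%R.
Proof.
move=> f g h; apply: dualP => X; rewrite dualDE /=.
move: (comul X); apply: tlift_ext => [||a b].
- exact/tlift_linear/(dual_tensor_bilin (f + g) h).
- by move=> c s t; rewrite !(tlift_linear (dual_tensor_bilin _ _)) scalerDr addrACA.
rewrite (tliftE (dual_tensor_bilin (f + g) h)) !(tliftE (dual_tensor_bilin _ _)).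
by rewrite /dual_tensor -mulrDl.
Qed.

Lemma convDr : right_distributive conv +%R.
Proof.
move=> f g h; apply: dualP => X; rewrite dualDE /=.
move: (comul X); apply: tlift_ext => [||a b].
- exact/tlift_linear/(dual_tensor_bilin f (g + h)).
- by move=> c s t; rewrite !(tlift_linear (dual_tensor_bilin _ _)) scalerDr addrACA.
rewrite (tliftE (dual_tensor_bilin f (g + h))) !(tliftE (dual_tensor_bilin _ _)).
by rewrite /dual_tensor -mulrDr.
Qed.

Lemma conv1f : left_id dual_one conv.
Proof.
move=> f; apply: dualP => X /=; rewrite -[in RHS](counitl X).
have bs : bilin (fun a b : U => counit a *: b).
  by split=> [b c a a'|a c b b']; rewrite ?linearP ?scalerDl ?scalerDr !scalerA // mulrC.
move: (comul X); apply: tlift_ext => [||a b].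
- exact/tlift_linear/(dual_tensor_bilin dual_one f).
- by move=> c s t; rewrite (tlift_linear bs) linearP.
by rewrite (tliftE (dual_tensor_bilin dual_one f)) (tliftE bs) linearZ.
Qed.

Lemma convf1 : right_id dual_one conv.
Proof.
move=> f; apply: dualP => X /=; rewrite -[in RHS](counitr X).
have bs : bilin (fun a b : U => counit b *: a).
  by split=> [b c a a'|a c b b']; rewrite ?linearP ?scalerDl ?scalerDr !scalerA // mulrC.
move: (comul X); apply: tlift_ext => [||a b].
- exact/tlift_linear/(dual_tensor_bilin f dual_one).
- by move=> c s t; rewrite (tlift_linear bs) linearP.
rewrite (tliftE (dual_tensor_bilin f dual_one)) (tliftE bs) linearZ.
exact: mulrC.
Qed.

Lemma dual_one_neq0 : dual_one != 0.
Proof.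
apply/eqP => /(congr1 (fun f : dual => f 1)) /=; rewrite counit1 => /eqP.
by rewrite [X in _ == X](_ : _ = 0) // oner_eq0.
Qed.

HB.instance Definition _ := GRing.Zmodule_isNzRing.Build dual
  convA conv1f convf1 convDl convDr dual_one_neq0.

Lemma convZl c (f g : dual) : c *: (f * g) = (c *: f) * g.
Proof.
apply: dualP => X; rewrite dualZE /=.
move: (comul X); apply: tlift_ext => [||a b].
- by move=> d s t; rewrite (tlift_linear (dual_tensor_bilin _ _)) mulrDr; congr (_ + _); exact: mulrCA.
- exact/tlift_linear/(dual_tensor_bilin (c *: f) g).
rewrite (tliftE (dual_tensor_bilin (c *: f) g)) (tliftE (dual_tensor_bilin _ _)).
exact: mulrA.
Qed.
HB.instance Definition _ := GRing.Lmodule_isLalgebra.Build k dual convZl.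

Lemma convZr c (f g : dual) : c *: (f * g) = f * (c *: g).
Proof.
apply: dualP => X; rewrite dualZE /=.
move: (comul X); apply: tlift_ext => [||a b].
- by move=> d s t; rewrite (tlift_linear (dual_tensor_bilin _ _)) mulrDr; congr (_ + _); exact: mulrCA.
- exact/tlift_linear/(dual_tensor_bilin f (c *: g)).
rewrite (tliftE (dual_tensor_bilin f (c *: g))) (tliftE (dual_tensor_bilin _ _)).
exact: mulrCA.
Qed.
HB.instance Definition _ := GRing.Lalgebra_isAlgebra.Build k dual convZr.

Lemma dual_mulE (f g : dual) X :
  (f * g) X = tlift (fun a b => f a * g b : k^o) (comul X).
Proof. by []. Qed.

Lemma dual_oneE X : (1 : dual) X = counit X. Proof. by []. Qed.

End Dual.

Inductive subalg_gen (k : fieldType) (A : algType k) (X : set A) : set A :=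
| subalg_mem a of X a : subalg_gen X a
| subalg_one : subalg_gen X 1
| subalg_lin c a b of subalg_gen X a & subalg_gen X b : subalg_gen X (c *: a + b)
| subalg_mul a b of subalg_gen X a & subalg_gen X b : subalg_gen X (a * b).

(* A finite-dimensional complex simple Lie algebra, presented by its
   indecomposable Cartan matrix of finite type: cart i j = (alpha_i^vee, alpha_j)
   and symz i = (alpha_i, alpha_i) / 2, so that (alpha_i, alpha_j) = symz i * cart i j
   and the shortest simple roots have (alpha_i, alpha_i) = 2. *)
Record cartan_datum := CartanDatum {
  rk :> nat;
  cart : 'I_rk -> 'I_rk -> int;
  symz : 'I_rk -> nat;
  cart_diag : forall i, cart i i = 2;
  cart_offdiag : forall i j, i != j -> cart i j <= 0;
  cart_sym : forall i j, (symz i)%:Z * cart i j = (symz j)%:Z * cart j i;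
  cart_posdef : forall c : 'I_rk -> rat, (exists i, c i != 0) ->
    0 < \sum_i \sum_j ((symz i)%:Z * cart i j)%:~R * c i * c j;
  cart_indec : forall J : {set 'I_rk},
    (forall i j, i \in J -> j \notin J -> cart i j = 0) ->
    J = finset.set0 \/ J = [set: 'I_rk]%SET;
  symz_gt0 : forall i, (0 < symz i)%N;
  symz_min : exists i, symz i = 1%N
}.

Section Roots.
Variable D : cartan_datum.

(* Coordinates are taken with respect to the simple roots. *)
Inductive is_root : ('I_D -> int) -> Prop :=
| root_simple i : is_root (fun j => (i == j)%:Z)
| root_refl i b of is_root b :
    is_root (fun j => b j - (\sum_l cart i l * b l) * (i == j)%:Z).

Definition highest_root (t : 'I_D -> int) :=
  is_root t /\ forall b, is_root b -> forall j, b j <= t j.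

Definition cominuscule (x : 'I_D) := exists2 t, highest_root t & t x = 1.

(* Dominant weights by their coordinates in the fundamental weights, so that
   (alpha_i, lam) = symz i * lam i. *)
Definition fund_weight (x : 'I_D) : 'I_D -> nat := fun i => (i == x)%N.
End Roots.

Section QuantumGroup.
Variables (k : fieldType) (D : cartan_datum) (q : k).

Definition qi (i : 'I_D) : k := q ^+ symz i.
Definition qint (p : k) (n : nat) : k := (p ^+ n - p ^- n) / (p - p^-1).
Definition qfact (p : k) (n : nat) : k := \prod_(1 <= m < n.+1) qint p m.
Definition qbinom (p : k) (n r : nat) : k :=
  qfact p n / (qfact p r * qfact p (n - r)).

Definition qserre (A : algType k) (e : 'I_D -> A) (i j : 'I_D) : Prop :=
  let m := `|1 - cart i j|%N in
  \sum_(r < m.+1) ((-1) ^+ r * qbinom (qi i) m r) *: (e i ^+ (m - r) * e j * e i ^+ r)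
    = 0.

Record Uq_relations (A : algType k) (E F K K' : 'I_D -> A) : Prop := {
  rel_KK' : forall i, K i * K' i = 1;
  rel_K'K : forall i, K' i * K i = 1;
  rel_KK : forall i j, K i * K j = K j * K i;
  rel_KE : forall i j, K i * E j = (qi i ^ cart i j) *: (E j * K i);
  rel_KF : forall i j, K i * F j = (qi i ^ (- cart i j)) *: (F j * K i);
  rel_EF : forall i j, E i * F j - F j * E i
    = ((i == j)%:R / (qi i - (qi i)^-1)) *: (K i - K' i);
  rel_serreE : forall i j, i != j -> qserre E i j;
  rel_serreF : forall i j, i != j -> qserre F i j
}.

Definition Ugens (A : algType k) (E F K K' : 'I_D -> A) : set A :=
  [set a | exists i, [\/ a = E i, a = F i, a = K i | a = K' i]].

Record qgroup := QGroup {
  qg_hopf :> hopf k;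
  gE : 'I_D -> qg_hopf;
  gF : 'I_D -> qg_hopf;
  gK : 'I_D -> qg_hopf;
  gK' : 'I_D -> qg_hopf;
  qg_rel : Uq_relations gE gF gK gK';
  qg_gen : forall X, subalg_gen (Ugens gE gF gK gK') X;
  qg_univ : forall (A : algType k) (e f c c' : 'I_D -> A),
    Uq_relations e f c c' -> exists phi : {lrmorphism qg_hopf -> A},
      forall i, [/\ phi (gE i) = e i, phi (gF i) = f i,
                    phi (gK i) = c i & phi (gK' i) = c' i];
  comul_gK : forall i, comul (gK i) = tpure (gK i) (gK i);
  comul_gE : forall i, comul (gE i) = tpure (gE i) (gK i) + tpure 1 (gE i);
  comul_gF : forall i, comul (gF i) = tpure (gF i) 1 + tpure (gK' i) (gF i);
  counit_gK : forall i, counit (gK i) = 1;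
  counit_gE : forall i, counit (gE i) = 0;
  counit_gF : forall i, counit (gF i) = 0
}.

End QuantumGroup.

Section Modules.
Variables (k : fieldType) (U : hopf k).

Record umod := UMod {
  umod_car :> vectType k;
  uact : U -> umod_car -> umod_car;
  uact_bilin : bilin uact;
  uact1 : forall w, uact 1 w = w;
  uactM : forall X Y w, uact (X * Y) w = uact X (uact Y w)
}.

Definition irreducible_mod (V : umod) : Prop :=
  (0 < \dim {:V})%N /\
  forall W : {vspace V}, (forall X w, w \in W -> uact X w \in W) ->
    W = 0%VS \/ W = {:V}%VS.

Section Coefficients.
Variables (V : umod) (f : {linear V -> k^o}) (w : V).

Lemma mcoef_linear : linear (fun X => f (uact X w) : k^o).
Proof. by move=> c X Y; rewrite (uact_bilin V).1 linearP. Qed.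

Definition mcoef : dual U := mkdual mcoef_linear.

Definition contragredient (X : U) (g : V -> k^o) : V -> k^o :=
  fun u => g (uact (antipode X) u).

Lemma dual_mcoef_linear : linear (fun X => contragredient X f w : k^o).
Proof.
by move=> c X Y; rewrite /contragredient linearP (uact_bilin V).1 linearP.
Qed.

(* the coefficient c_{w,f} of the dual module V^* *)
Definition dual_mcoef : dual U := mkdual dual_mcoef_linear.
End Coefficients.

Lemma dual_lact_linear (X : U) (a : dual U) : linear (fun Y => a (Y * X) : k^o).
Proof. by move=> c Y Z; rewrite mulrDl -scalerAl linearP. Qed.

Lemma dual_ract_linear (a : dual U) (X : U) : linear (fun Y => a (X * Y) : k^o).
Proof. by move=> c Y Z; rewrite mulrDr -scalerAr linearP. Qed.

(* X |> a = a_(1) a_(2)(X) and a <| X = a_(1)(X) a_(2), evaluated at Y *)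
Definition dual_lact X a : dual U := mkdual (dual_lact_linear X a).
Definition dual_ract a X : dual U := mkdual (dual_ract_linear a X).

(* [s] represents the coproduct a_(1) (x) a_(2) of [a], as an element of A (x) B *)
Definition coprod_in (A B : set (dual U)) (a : dual U)
    (s : seq (dual U * dual U)) : Prop :=
  (forall p, p \in s -> A p.1 /\ B p.2) /\
  (forall X Y, a (X * Y) = \sum_(p <- s) p.1 X * p.2 Y).

End Modules.

Section Calculus.
Variables (k : fieldType) (A : algType k).

(* A first-order differential calculus over a subalgebra B of A. The two actions
   and the derivation are only constrained, and only used, on B. *)
Record fodc (B : set A) := Fodc {
  fodc_car :> lmodType k;
  flact : A -> fodc_car -> fodc_car;
  fract : fodc_car -> A -> fodc_car;
  fdiff : A -> fodc_car;
  flact_linr : forall b, B b -> linear (flact b);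
  flact_linl : forall c b b' w, B b -> B b' ->
    flact (c *: b + b') w = c *: flact b w + flact b' w;
  flact1 : forall w, flact 1 w = w;
  flactM : forall b b' w, B b -> B b' -> flact (b * b') w = flact b (flact b' w);
  fract_linl : forall b, B b -> linear (fract^~ b);
  fract_linr : forall c b b' w, B b -> B b' ->
    fract w (c *: b + b') = c *: fract w b + fract w b';
  fract1 : forall w, fract w 1 = w;
  fractM : forall b b' w, B b -> B b' -> fract w (b * b') = fract (fract w b) b';
  flractA : forall b b' w, B b -> B b' ->
    fract (flact b w) b' = flact b (fract w b');
  fdiff_lin : forall c b b', B b -> B b' ->
    fdiff (c *: b + b') = c *: fdiff b + fdiff b';
  fdiffM : forall b b', B b -> B b' ->
    fdiff (b * b') = fract (fdiff b) b' + flact b (fdiff b');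
  fodc_gen : forall w,
    lspan [set u | exists b b', [/\ B b, B b' & u = flact b (fdiff b')]] w
}.

Variables (P : set A) (Om : fodc P).

Definition fodc_restr (B : set A) : set Om :=
  lspan [set w | exists b b1 b2, [/\ B b, B b1, B b2 &
    w = fract (flact b1 (fdiff Om b)) b2]].

Definition lr_ideal (W : set Om) : set Om :=
  lspan [set w | exists p p' u, [/\ P p, P p', W u & w = fract (flact p u) p']].

Definition r_ideal (W : set Om) : set Om :=
  lspan [set w | exists p u, [/\ P p, W u & w = fract u p]].

(* O(U_1) = k[t, t^-1] with t grouplike; t^n is << n >>, and t^m t^n = t^(m + n) *)
Definition OU1 := {malg k[int]}.
HB.instance Definition _ := GRing.Lmodule.on OU1.
Definition tU1 (n : int) : OU1 := << n >>.

(* A Z-grading of the algebra P, that is, a right O(U_1)-comodule algebra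
   structure p |-> p (x) t^n for p in deg n. *)
Record Zgrading (deg : int -> set A) : Prop := {
  deg_lin : forall n c p p', deg n p -> deg n p' -> deg n (c *: p + p');
  deg_zero : forall n, deg n 0;
  deg_one : deg 0 1;
  deg_mul : forall m n p p', deg m p -> deg n p' -> deg (m + n) (p * p');
  deg_span : forall p, P p <-> exists (s : seq int) (c : int -> A),
    (forall n, deg n (c n)) /\ p = \sum_(n <- s) c n;
  deg_free : forall (s : seq int) (c : int -> A), uniq s ->
    (forall n, deg n (c n)) -> \sum_(n <- s) c n = 0 ->
    forall n, n \in s -> c n = 0
}.

Definition right_covariance (deg : int -> set A)
    (dR : {linear Om -> tens Om OU1}) : Prop :=
  forall m n p p', deg m p -> deg n p' ->
    dR (flact p (fdiff Om p')) = tpure (flact p (fdiff Om p')) (tU1 (m + n)).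

Record principal_connection (B : set A) (dR : {linear Om -> tens Om OU1})
    (Pi : {linear Om -> Om}) : Prop := {
  pc_left : forall p w, P p -> Pi (flact p w) = flact p (Pi w);
  pc_right : forall w, dR (Pi w) = tmap Pi idfun (dR w);
  pc_proj : forall w, Pi (Pi w) = Pi w;
  pc_ker : [set w | Pi w = 0] = lr_ideal (fodc_restr B)
}.

Definition strong_connection (B : set A) (Pi : {linear Om -> Om}) : Prop :=
  forall p, P p -> r_ideal (fodc_restr B) (fdiff Om p - Pi (fdiff Om p)).

End Calculus.

Arguments fodc_restr {k A P} Om B.

Section LeftCovariance.
Variables (k : fieldType) (U : hopf k) (G P : set (dual U)) (Om : fodc P).

Definition left_covariance (dL : {linear Om -> tens (dual U) Om}) : Prop :=
  forall p p' s s', P p -> P p' -> coprod_in G P p s -> coprod_in G P p' s' ->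
    dL (flact p (fdiff Om p')) =
      \sum_(x <- s) \sum_(y <- s') tpure (x.1 * y.1) (flact x.2 (fdiff Om y.2)).

Definition left_covariant_map (dL : {linear Om -> tens (dual U) Om})
    (Pi : {linear Om -> Om}) : Prop :=
  forall w, dL (Pi w) = tmap idfun Pi (dL w).
End LeftCovariance.

Section FlagManifold.
Variables (k : fieldType) (D : cartan_datum) (q : k) (U : qgroup D q).

(* V is V_lam, with highest weight vector w *)
Definition hw_module (V : umod U) (lam : 'I_D -> nat) (w : V) : Prop :=
  [/\ irreducible_mod V, w != 0, forall i, uact (gE U i) w = 0 &
      forall i, uact (gK U i) w = q ^+ (symz i * lam i) *: w].

Definition Oq : set (dual U) :=
  lspan [set c | exists (V : umod U) (lam : 'I_D -> nat) (w : V),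
    hw_module lam w /\ exists (f : {linear V -> k^o}) (v : V), c = mcoef f v].

Definition Uq_l (S : {set 'I_D}) : set U :=
  subalg_gen [set X | (exists i, X = gK U i \/ X = gK' U i) \/
                      (exists2 j, j \in S & X = gE U j \/ X = gF U j)].

Definition Uq_ls (S : {set 'I_D}) : set U :=
  subalg_gen [set X | exists2 j, j \in S &
    [\/ X = gK U j, X = gK' U j, X = gE U j | X = gF U j]].

Definition invariants (K : set U) : set (dual U) :=
  [set b | Oq b /\ forall X, K X -> dual_lact X b = (counit X : k) *: b].

Definition OqGL (S : {set 'I_D}) := invariants (Uq_l S).
Definition OqGLs (S : {set 'I_D}) := invariants (Uq_ls S).

Definition weight_basis (V : umod U) (n : nat) (v : 'I_n -> V) : Prop :=
  basis_of {:V}%VS [tuple v i | i < n] /\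
  forall j, exists mu : 'I_D -> int, forall i,
    uact (gK U i) (v j) = q ^ ((symz i)%:Z * mu i) *: v j.

Definition dual_basis (V : umod U) (n : nat) (v : 'I_n -> V)
    (f : 'I_n -> {linear V -> k^o}) : Prop :=
  forall i j, f i (v j) = (i == j)%:R.

Section Irreducible.
Variable x : 'I_D.
Let S : {set 'I_D} := [set~ x]%SET.
Let B := OqGL S.

Definition Bplus : set (dual U) := [set b | B b /\ b 1 = 0].

(* T^(0,1) consists of the functionals b |-> b (Y E_x), Y in U_q(l_S) *)
Definition I01 : set (dual U) :=
  [set b | Bplus b /\ forall Y, Uq_l S Y -> b (Y * gE U x) = 0].

(* V = B^+ / I is the image of B^+ in U^* / I; accordingly O_q(G) (x) V sits in
   U^* (x) (U^* / I). *)
Definition cls01 (b : dual U) : lquot I01 := lproj I01 b.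

Definition rep01 (s : seq (dual U * dual U)) : tens (dual U) (lquot I01) :=
  \sum_(p <- s) tpure p.1 (cls01 p.2).

Definition admissible01 (s : seq (dual U * dual U)) : Prop :=
  forall p, p \in s -> Oq p.1 /\ Bplus p.2.

Definition Omega01 : set (tens (dual U) (lquot I01)) :=
  [set w | exists s, [/\ admissible01 s, w = rep01 s &
    forall Y, Uq_l S Y ->
      rep01 [seq (dual_lact Y p.1, p.2) | p <- s] =
      rep01 [seq (p.1, dual_ract p.2 Y) | p <- s]]].

(* phi is an isomorphism from the restriction of Om to B = O_q(G/L_S) onto the
   calculus Omega^(0,1)_q(G/L_S) *)
Record restr_iso01 (P : set (dual U)) (Om : fodc P)
    (phi : {linear Om -> tens (dual U) (lquot I01)}) : Prop := {
  iso01_inj : forall w, fodc_restr Om B w -> phi w = 0 -> w = 0;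
  iso01_im : phi @` fodc_restr Om B = Omega01;
  iso01_lact : forall b w s, B b -> fodc_restr Om B w -> admissible01 s ->
    phi w = rep01 s -> phi (flact b w) = rep01 [seq (b * p.1, p.2) | p <- s];
  iso01_ract : forall b w s t, B b -> fodc_restr Om B w -> admissible01 s ->
    phi w = rep01 s -> coprod_in Oq B b t ->
    phi (fract w b) = rep01 [seq (p.1 * r.1, p.2 * r.2) | p <- s, r <- t];
  iso01_diff : forall b t, B b -> coprod_in Oq B b t ->
    phi (fdiff Om b) = rep01 [seq (p.1, p.2 - (p.2 1 : k) *: (1 : dual U)) |
                           p : dual U * dual U <- t]
}.

End Irreducible.
End FlagManifold.

Arguments Oq {k D q} U.
Arguments OqGL {k D q} U S.
Arguments OqGLs {k D q} U S.
Arguments I01 {k D q} U x.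
Arguments hw_module {k D q U} V lam w.

(* Main.v *)
Require Import Defs.
From mathcomp Require Import all_boot all_algebra classical_sets reals complex.
Import GRing.Theory.
Local Open Scope classical_set_scope.
Local Open Scope ring_scope.
Local Open Scope complex_scope.

(** The zero map is trivially a left [P]-linear, bi-covariant idempotent; its
    kernel is everything, so both remaining claims, [ker = P Omega^1(B) P] and
    strongness, follow once every differential [d p] lies in
    [Omega^1(B) P].

    Let [p] have degree [n], and suppose that [1 = sum_i a_i b_i] with [a_i] of
    degree [- n], [b_i] of degree [n], and [sum_i a_i d(b_i) = 0].  Then
    [p = sum_i (p a_i) b_i] with [p a_i] in [B], and the Leibniz rule gives
    [d p = sum_i d(p a_i) b_i], because the other half of it is
    [p sum_i a_i d(b_i)].  Such a family is called a flat frame of degree [n]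
    below.  Nesting a frame of degree [m] around one of degree [n] gives a frame
    of degree [m + n] ([flat_frameD]), so frames of degree 1 and -1 suffice.

    Degree 1: [sum_i zbar_i z_i = 1] is the antipode axiom read on matrix
    coefficients ([dual_mcoef_sum]), and [d z_i = 0].

    Degree -1: a relation [sum_i z_i y_i = 1] with [y_i] of degree -1 is needed;
    flatness is then automatic, since [sum_i z_i d(y_i) = d 1 - sum_i d(z_i) y_i].
    The order of the factors is now opposite to that of the antipode axiom, and
    the square of the antipode enters: if [A] is an operator on the module with
    [A X = S^2(X) A], then [S(X_2) A X_1 = S(S(X_1) X_2) A = eps(X) A], and the
    diagonal [A] gives [y_i] proportional to [zbar_i] ([mcoef_dual_sum]).  Such
    an [A] is, up to a scalar, the action of [K_(2 rho)]; it is built directly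
    on a weight basis in [twist_exists], by solving
    [(rho, alpha_l) = (alpha_l, alpha_l) / 2] over the rationals and extracting a
    root of [q ^ 2] to clear denominators.  There the fact that [q] is not a root
    of unity enters, as it makes a weight determined by its eigenvalues. *)

Set Implicit Arguments.
Unset Strict Implicit.
Unset Printing Implicit Defensive.
Import Num.Theory.

(** * Linear and tensor preliminaries *)

Section Unbundled.
Variables (k : fieldType) (V W : lmodType k) (g : V -> W).
Hypothesis lg : linear g.

Lemma lin0 : g 0 = 0.
Proof. by have := lg (-1) 0 0; rewrite !scaleN1r oppr0 addr0 addNr. Qed.

Lemma linZ c u : g (c *: u) = c *: g u.
Proof. by have := lg c u 0; rewrite lin0 !addr0. Qed.

Lemma linD u v : g (u + v) = g u + g v.
Proof. by have := lg 1 u v; rewrite !scale1r. Qed.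

Lemma lin_sum (I : eqType) (s : seq I) (F : I -> V) :
  g (\sum_(i <- s) F i) = \sum_(i <- s) g (F i).
Proof. exact: (big_morph g linD lin0). Qed.
End Unbundled.

Lemma tmap0 (k : fieldType) (A M A' M' : lmodType k) (f : A -> A') (g : M -> M') t :
  (forall a, f a = 0) \/ (forall m, g m = 0) -> tmap f g t = 0.
Proof.
move=> fg; rewrite /tmap tlift.unlock; apply: big1 => p _.
have [bl br] := tpure_bilin A' M'.
by case: fg => ->; rewrite ?(lin0 (bl _)) ?(lin0 (br _)) scaler0.
Qed.

Lemma lspan_sum (k : fieldType) (V : lmodType k) (X : set V) (I : eqType)
    (s : seq I) (F : I -> V) :
  (forall i, i \in s -> lspan X (F i)) -> lspan X (\sum_(i <- s) F i).
Proof.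
move=> sF; rewrite big_seq; elim/big_ind: _ => //; first by left.
exact: lspanD.
Qed.

Section Sweedler.
Variable k : fieldType.

Lemma tens_sum (A M : lmodType k) (t : tens A M) :
  exists s : seq (A * M), t = \sum_(p <- s) tpure p.1 p.2.
Proof.
elim/tens_ind: t => [|a m t [s ->]]; first by exists [::]; rewrite big_nil.
by exists ((a, m) :: s); rewrite big_cons.
Qed.

Lemma tlift_sum (A M W : lmodType k) (g : A -> M -> W) (s : seq (A * M)) :
  bilin g -> tlift g (\sum_(p <- s) tpure p.1 p.2) = \sum_(p <- s) g p.1 p.2.
Proof.
move=> bg; rewrite (lin_sum (tlift_linear bg)).
by apply: eq_bigr => p _; rewrite tliftE.
Qed.

Lemma bilin_mul (A : algType k) (W W' : lmodType k) (g : W -> A) (h : W' -> A) :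
  linear g -> linear h -> bilin (fun a b => g a * h b).
Proof.
move=> lg lh; split=> [b c a a'|a c b b'] /=.
  by rewrite lg mulrDl -scalerAl.
by rewrite lh mulrDr -scalerAr.
Qed.
End Sweedler.

(** * Flat frames and the calculus *)

Section Calculus.
Variables (k : fieldType) (A : algType k) (P : set A) (Om : fodc P).
Variable deg : int -> set A.
Hypothesis gr : Zgrading P deg.

Let d := fdiff Om.

Let lact_lin b (Pb : P b) : linear (flact (f := Om) b) := flact_linr Pb.
Let ract_lin b (Pb : P b) : linear (fun w : Om => fract w b) := fract_linl Pb.

Lemma deg_sub n p : deg n p -> P p.
Proof.
move=> np; apply/(deg_span gr); exists [:: n], (fun m => if m == n then p else 0).
split=> [m|]; last by rewrite big_seq1 eqxx.
by case: eqP => [->|_] //; apply: deg_zero gr _.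
Qed.

Lemma degD n p p' : deg n p -> deg n p' -> deg n (p + p').
Proof. by move=> *; rewrite -[p]scale1r; apply: deg_lin gr _ _ _ _ _ _. Qed.

Lemma deg_sum n (I : eqType) (s : seq I) (F : I -> A) :
  (forall i, i \in s -> deg n (F i)) -> deg n (\sum_(i <- s) F i).
Proof.
move=> sF; rewrite big_seq; elim/big_ind: _ => //; first exact: deg_zero gr _.
exact: degD.
Qed.

Lemma graded_sum_sub (s : seq int) (c : int -> A) :
  (forall n, deg n (c n)) -> P (\sum_(n <- s) c n).
Proof. by move=> cn; apply/(deg_span gr); exists s, c. Qed.

Lemma diff0 : d 0 = 0.
Proof.
have P0 := deg_sub (deg_zero gr 0).
by have := fdiff_lin Om (-1) P0 P0; rewrite !scaleN1r oppr0 addr0 addNr.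
Qed.

Lemma diff_graded_sum (s : seq int) (c : int -> A) :
  (forall n, deg n (c n)) -> d (\sum_(n <- s) c n) = \sum_(n <- s) d (c n).
Proof.
move=> cn; elim: s => [|n s IH]; first by rewrite !big_nil diff0.
rewrite !big_cons -IH -[c n in LHS]scale1r /d fdiff_lin ?scale1r //.
  exact: deg_sub (cn n).
exact: graded_sum_sub.
Qed.

Lemma diff_sum n (I : eqType) (s : seq I) (F : I -> A) :
  (forall i, i \in s -> deg n (F i)) ->
  d (\sum_(i <- s) F i) = \sum_(i <- s) d (F i).
Proof.
elim: s => [|i s IH] sF; first by rewrite !big_nil diff0.
have sF' j : j \in s -> deg n (F j) by move=> js; apply: sF; rewrite inE js orbT.
rewrite !big_cons -IH // -[F i in LHS]scale1r /d fdiff_lin ?scale1r //.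
  by apply: (@deg_sub n); apply: sF; rewrite inE eqxx.
by apply: (@deg_sub n); apply: deg_sum.
Qed.

Lemma diff1 : d 1 = 0.
Proof.
have P1 := deg_sub (deg_one gr).
have := fdiffM Om P1 P1; rewrite mulr1 fract1 flact1 -/d.
by move/(congr1 (fun w => w - d 1)); rewrite addrK subrr => <-.
Qed.

(** Any partition of unity [1 = sum_i a_i b_i] of this degree defines the
    connection [p |-> sum_i d(p a_i) b_i] on the elements of degree [n]; the last
    condition makes this connection equal to [d]. *)
Definition flat_frame (n : int) (s : seq (A * A)) : Prop :=
  [/\ forall r, r \in s -> deg (- n) r.1 /\ deg n r.2,
      \sum_(r <- s) r.1 * r.2 = 1 &
      \sum_(r <- s) flact r.1 (d r.2) = 0].

Lemma flat_frame0 : flat_frame 0 [:: (1, 1)].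
Proof.
split; last by rewrite big_seq1 flact1 diff1.
  by move=> r; rewrite inE => /eqP -> /=; rewrite oppr0; split; apply: deg_one gr.
by rewrite big_seq1 mulr1.
Qed.

(** Nesting [1 = sum_u u_1 u_2] inside [1 = sum_r r_1 r_2] as
    [sum_(r, u) r_1 (u_1 u_2) r_2]; the factors of degree [- (m + n)] then stay on the
    left without any commutation relation. *)
Lemma flat_frameD m n s t :
  flat_frame m s -> flat_frame n t ->
  flat_frame (m + n) [seq (r.1 * u.1, u.2 * r.2) | r <- s, u <- t].
Proof.
move=> [s_deg s1 s0] [t_deg t1 t0].
have Psub := @deg_sub; split.
- move=> _ /allpairsP[[r u] /= [rs ut ->]] /=.
  have [r1 r2] := s_deg r rs; have [u1 u2] := t_deg u ut; split.
    by rewrite opprD; apply: deg_mul gr _ _ _ _ _ _.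
  by rewrite addrC; apply: deg_mul gr _ _ _ _ _ _.
- rewrite big_allpairs_dep /= -[RHS]s1; apply: eq_bigr => r _ /=.
  transitivity (r.1 * (\sum_(u <- t) u.1 * u.2) * r.2); last by rewrite t1 mulr1.
  by rewrite mulr_sumr mulr_suml; apply: eq_bigr => u _; rewrite !mulrA.
rewrite big_allpairs_dep /= -[RHS]s0 big_seq [RHS]big_seq.
apply: eq_bigr => r /s_deg[/Psub Pr1 /Psub Pr2] /=.
(* the Leibniz rule splits the inner sum; its first half vanishes because [t]
   is flat, and its second half is [d(r.2)] because [t] is a partition of 1 *)
transitivity (flact (f := Om) r.1 (fract (\sum_(u <- t) flact u.1 (d u.2)) r.2
                + flact (\sum_(u <- t) u.1 * u.2) (d r.2))); last first.
  rewrite t0 t1 flact1 (lin0 (ract_lin Pr2)) add0r //.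
have -> : flact (f := Om) (\sum_(u <- t) u.1 * u.2) (d r.2) =
    \sum_(u <- t) flact (u.1 * u.2) (d r.2).
  have: forall u, u \in t -> deg 0 (u.1 * u.2).
    move=> u /t_deg[u1 u2]; have := deg_mul gr u1 u2; by rewrite addNr.
  have P0 := deg_sub (deg_zero gr 0).
  have f0 : flact (f := Om) 0 (d r.2) = 0.
    have := flact_linl (f := Om) (-1) (d r.2) P0 P0.
    by rewrite !scaleN1r oppr0 addr0 addNr.
  elim: (t) => [|u t' IH] ut; first by rewrite !big_nil f0.
  have ut' v : v \in t' -> deg 0 (v.1 * v.2).
    by move=> vt; apply: ut; rewrite inE vt orbT.
  rewrite !big_cons -IH // -[u.1 * u.2 in LHS]scale1r flact_linl ?scale1r //.
    by apply: (@deg_sub 0); apply: ut; rewrite inE eqxx.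
  by apply: (@deg_sub 0); apply: deg_sum.
rewrite (lin_sum (ract_lin Pr2)) -big_split /= (lin_sum (lact_lin Pr1)).
rewrite big_seq [RHS]big_seq; apply: eq_bigr => u /t_deg[u1 u2].
have [/Psub Pu1 /Psub Pu2] := (u1, u2).
rewrite flactM // /d fdiffM // flractA // flactM //; congr (flact _ _).
by rewrite (linD (lact_lin Pu1)).
Qed.

Lemma flat_frame_exists n sp sm :
  flat_frame 1 sp -> flat_frame (-1) sm -> exists s, flat_frame n s.
Proof.
move=> sp1 sm1; elim: n => [|n [s ns]|n [s ns]]; first by exists [:: (1, 1)]; apply: flat_frame0.
  by eexists; rewrite -addn1 PoszD; apply: flat_frameD ns sp1.
by eexists; rewrite -addn1 PoszD opprD; apply: flat_frameD ns sm1.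
Qed.

Variable B : set A.
Hypothesis deg0 : deg 0 = B.

(** By Leibniz, [d p = sum_r d(p r_1) r_2 + p sum_r r_1 d(r_2)]; the second term
    vanishes by flatness and [p r_1] has degree 0. *)
Lemma flat_frame_diff n s p : flat_frame n s -> deg n p ->
  r_ideal (fodc_restr Om B) (d p).
Proof.
have Psub := @deg_sub.
have B1 : B 1 by rewrite -deg0; apply: deg_one gr.
move=> [s_deg s1 s0] np.
have pr r : r \in s -> deg 0 (p * r.1).
  by move=> /s_deg[r1 _]; have := deg_mul gr np r1; rewrite subrr.
have Pp := Psub _ _ np.
have -> : d p = \sum_(r <- s) fract (d (p * r.1)) r.2.
  have p_sum : p = \sum_(r <- s) p * r.1 * r.2.
    by rewrite -[LHS]mulr1 -s1 mulr_sumr; apply: eq_bigr => r _; rewrite mulrA.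
  rewrite {1}p_sum (@diff_sum n) => [|r rs]; last first.
    by rewrite -[n]add0r; apply: deg_mul gr _ _ _ _ (pr r rs) (s_deg r rs).2.
  have p0 : \sum_(r <- s) flact (f := Om) p (flact r.1 (d r.2)) = 0.
    by rewrite -(lin_sum (lact_lin Pp)) s0 (lin0 (lact_lin Pp)).
  rewrite -[RHS]addr0 -[X in _ + X]p0 -big_split /= big_seq [RHS]big_seq.
  apply: eq_bigr => r rs; have [/Psub Pr1 /Psub Pr2] := s_deg r rs.
  by rewrite /d fdiffM ?flactM //; exact: Psub (pr r rs).
apply: lspan_sum => r rs; apply: lspan_mem; exists r.2, (d (p * r.1)); split=> //.
  exact: Psub (s_deg r rs).2.
apply: lspan_mem; exists (p * r.1), 1, 1.
by rewrite flact1 fract1; split=> //; rewrite -deg0; apply: pr.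
Qed.

Lemma diff_in_r_ideal sp sm : flat_frame 1 sp -> flat_frame (-1) sm ->
  forall p, P p -> r_ideal (fodc_restr Om B) (d p).
Proof.
move=> sp1 sm1 p /(deg_span gr)[s [c [cn ->]]]; rewrite diff_graded_sum //.
apply: lspan_sum => n _; have [t nt] := flat_frame_exists n sp1 sm1.
exact: flat_frame_diff nt (cn n).
Qed.

Lemma lr_ideal_setT (W : set Om) :
  (forall p, P p -> r_ideal W (d p)) -> lr_ideal W = [set: Om].
Proof.
move=> dW; apply/seteqP; split=> // w _.
elim: (fodc_gen w) => [|c _ u [b [b' [Pb Pb' ->]]] _ Wu]; first by left.
apply: lspan_lin Wu.
have: r_ideal W (fdiff Om b') by exact: dW.
elim=> [|e _ t [p [y [Pp Wy ->]]] _ IH].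
  by rewrite (lin0 (lact_lin Pb)); left.
rewrite (linD (lact_lin Pb)) (linZ (lact_lin Pb)).
apply: lspan_lin IH; apply: lspan_mem.
by exists b, p, y; split=> //; rewrite flractA.
Qed.

End Calculus.

(** * The antipode *)

Section Hopf.
Variables (k : fieldType) (U : hopf k).

(** Sweedler notation: the pairs in [s] are the [X_(1), X_(2)]. *)
Lemma sweedler (X : U) : exists s : seq (U * U),
  forall (W : lmodType k) (g : U -> U -> W), bilin g ->
    tlift g (comul X) = \sum_(p <- s) g p.1 p.2.
Proof. by have [s ->] := tens_sum (comul X); exists s => W g; apply: tlift_sum. Qed.

(** The identity of [U] is invertible for convolution, with inverse [antipode], so
    convolving with it on the right is injective: from [T * id = 0] one gets
    [T(Y) = T(Y_1) Y_2 S(Y_3) = 0]. *)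
Lemma conv_id_inj (T : U -> U) : linear T ->
  (forall Y, tlift (fun a b => T a * b) (comul Y) = 0) -> forall Y, T Y = 0.
Proof.
move=> lT T0 Y.
have bp (A M : lmodType k) := tpure_bilin A M.
have bS (a : U) : bilin (fun b c : U => a * (b * antipode c)).
  have := bilin_mul (g := fun b : U => a * b) (h := @antipode k U).
  move=> bm; have [] : bilin (fun b c : U => (a * b) * antipode c).
    by apply: bm => c b b'; rewrite ?linearP // mulrDr -scalerAr.
  by move=> l r; split=> [c|b] e u v; rewrite !mulrA ?(l c) ?(r b).
pose F a (t : tens U U) : U := T a * tlift (fun b c => b * antipode c) t.
have bS1 : bilin (fun b c : U => b * antipode c).
  by apply: (bilin_mul (g := fun b : U => b)) => // c u v; rewrite linearP.
have bF : bilin F by apply: bilin_mul => //; apply: tlift_linear.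
have b1 : bilin (fun a b => tpure (idfun a) (comul b) : tens U (tens U U)).
  split=> [b c a a'|a c b b'] /=; first exact: (bp _ _).1.
  by rewrite linearP; exact: (bp _ _).2.
have b3 (b : U) : bilin (fun a1 a2 : U => tpure a1 (tpure a2 b)).
  split=> [a2 c a a'|a c a2 a2'] /=; first exact: (bp _ _).1.
  by rewrite (bp _ _).1 (bp _ _).2.
have b2 : bilin (fun a b : U =>
    tlift (fun a1 a2 => tpure a1 (tpure a2 b)) (comul a)).
  split=> [b c a a'|a c b b'] /=; first by rewrite linearP (tlift_linear (b3 b)).
  have [s sE] := sweedler a; rewrite !sE // scaler_sumr -big_split.
  by apply: eq_bigr => p _; rewrite (bp _ _).2 (bp _ _).2.
have bT : bilin (fun a b : U => T a * b) by apply: (bilin_mul (h := fun b : U => b)).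
have bc : bilin (fun a b : U => counit b *: a).
  by split=> [b c a a'|a c b b']; rewrite ?linearP ?scalerDl ?scalerDr !scalerA // mulrC.
have [s sE] := sweedler Y.
transitivity (tlift F (tmap idfun comul (comul Y))).
  rewrite /tmap sE // (lin_sum (tlift_linear bF)) -[in LHS](counitr Y) sE //.
  rewrite (lin_sum lT); apply: eq_bigr => p _.
  by rewrite (tliftE bF) /F antipoder (linZ lT) -scalerAr mulr1.
rewrite -comulA sE // (lin_sum (tlift_linear bF)); apply: big1 => p _.
have [t tE] := sweedler p.1; rewrite tE // (lin_sum (tlift_linear bF)).
transitivity (tlift (fun a b => T a * b) (comul p.1) * antipode p.2); last first.
  by rewrite T0 mul0r.
rewrite tE // mulr_suml; apply: eq_bigr => r _.
by rewrite (tliftE bF) /F (tliftE bS1) mulrA.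
Qed.

Lemma antipode_mul_bilin : bilin (fun b c : U => antipode b * c).
Proof.
by apply: (bilin_mul (h := fun b : U => b)) => // c u v; rewrite linearP.
Qed.

Lemma antipode1 : antipode (1 : U) = 1.
Proof.
have := antipodel (1 : U).
by rewrite comul1 (tliftE antipode_mul_bilin) mulr1 counit1 scale1r.
Qed.

(** The difference [T(X, Y) = S(X Y) - S(Y) S(X)] satisfies
    [T(X_1, Y_1) X_2 Y_2 = eps(X Y) - eps(X) eps(Y) = 0]; cancelling [Y_2] and then
    [X_2] by [conv_id_inj] leaves [T = 0]. *)
Lemma antipodeM (X Y : U) : antipode (X * Y) = antipode Y * antipode X.
Proof.
have lS : linear (@antipode k U) by exact: linearP.
pose T X Y : U := antipode (X * Y) - antipode Y * antipode X.
have bT : bilin T.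
  split=> [b c a a'|a c b b']; rewrite /T.
    rewrite mulrDl -scalerAl !lS mulrDr -scalerAr scalerBr.
    by rewrite opprD addrACA.
  rewrite mulrDr -scalerAr !lS mulrDl -scalerAl scalerBr.
  by rewrite opprD addrACA.
have bTm A : bilin (fun a b : U => T a A * b).
  exact: (bilin_mul (h := fun b : U => b)) (bT.1 A) _.
pose T' X Y : U := tlift (fun a b => T a Y * b) (comul X).
have lT' A : linear (T' A).
  move=> c b b'; rewrite /T'; have [s sE] := sweedler A; rewrite !sE //.
  rewrite scaler_sumr -big_split; apply: eq_bigr => p _ /=.
  by rewrite (bT.2 p.1) mulrDl -scalerAl.
have bS := antipode_mul_bilin.
suff T'0 A B : T' A B = 0.
  have TX0 : T X Y = 0 by apply: (conv_id_inj (bT.1 Y)) => A; apply: T'0.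
  by apply/eqP; rewrite -subr_eq0; apply/eqP.
apply: (conv_id_inj (lT' A)) => {}B.
have bT' : bilin (fun a b : U => T' A a * b).
  exact: (bilin_mul (h := fun b : U => b)).
have [sA comA] := tens_sum (comul A); have [sB comB] := tens_sum (comul B).
pose G (a b : U) := tlift (fun a' b' : U => tpure (a * a') (b * b')) (comul B).
have bin (a b : U) : bilin (fun a' b' : U => tpure (a * a') (b * b')).
  split=> [b' c u v|a' c u v]; rewrite mulrDr -scalerAr.
    exact: (tpure_bilin _ _).1.
  exact: (tpure_bilin _ _).2.
have bG : bilin G.
  split=> [b c u v|a c u v]; rewrite /G comB !tlift_sum // scaler_sumr -big_split;
    apply: eq_bigr => p _ /=; rewrite mulrDl -scalerAl.
    exact: (tpure_bilin _ _).1.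
  exact: (tpure_bilin _ _).2.
have comAB : comul (A * B) =
    \sum_(p <- sA) \sum_(r <- sB) tpure (p.1 * r.1) (p.2 * r.2).
  rewrite comulM /tens_mul -/G comA tlift_sum //; apply: eq_bigr => p _.
  by rewrite /G comB tlift_sum.
rewrite comB tlift_sum //.
transitivity (\sum_(r <- sB) \sum_(p <- sA)
   (antipode (p.1 * r.1) * (p.2 * r.2)
    - antipode r.1 * (antipode p.1 * p.2) * r.2)).
  apply: eq_bigr => r _; rewrite /T' comA tlift_sum // mulr_suml.
  by apply: eq_bigr => p _; rewrite /T !mulrBl !mulrA.
transitivity (tlift (fun b c => antipode b * c) (comul (A * B))
   - \sum_(r <- sB) antipode r.1
       * tlift (fun b c => antipode b * c) (comul A) * r.2).
  rewrite comAB (lin_sum (tlift_linear bS)) exchange_big /=.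
  rewrite (eq_bigr (fun p => \sum_(r <- sB) antipode (p.1 * r.1) * (p.2 * r.2)
     - \sum_(r <- sB) antipode r.1 * (antipode p.1 * p.2) * r.2)); last first.
    by move=> p _; rewrite sumrB.
  rewrite sumrB; congr (_ - _).
    apply: eq_bigr => p _; rewrite (lin_sum (tlift_linear bS)).
    by apply: eq_bigr => r _; rewrite (tliftE bS).
  rewrite exchange_big; apply: eq_bigr => r _.
  by rewrite comA tlift_sum // mulr_sumr mulr_suml.
rewrite !antipodel.
have -> : \sum_(r <- sB) antipode r.1 * (counit A *: 1) * r.2 =
    counit A *: \sum_(r <- sB) antipode r.1 * r.2.
  rewrite scaler_sumr; apply: eq_bigr => r _.
  by rewrite -scalerAr mulr1 -scalerAl.
rewrite -(tlift_sum sB bS) -comB antipodel scalerA.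
by rewrite counitM subrr.
Qed.
End Hopf.

(** * Matrix coefficients and the twisted antipode relation *)

Lemma dual_sumE (k : fieldType) (U : hopf k) (I : eqType) (s : seq I)
    (F : I -> dual U) (X : U) :
  (\sum_(i <- s) F i) X = \sum_(i <- s) F i X.
Proof. exact: (lin_sum (g := fun h : dual U => h X : k^o)). Qed.

Section Coefficients.
Variables (k : fieldType) (U : hopf k) (V : umod U) (n : nat).
Variables (v : 'I_n -> V) (f : 'I_n -> {linear V -> k^o}).
Hypothesis v_basis : basis_of {:V}%VS [tuple v i | i < n].
Hypothesis f_dual : forall i j, f i (v j) = (i == j)%:R.

Lemma dual_basis_expand u : u = \sum_i f i u *: v i.
Proof.
have uE := coord_basis v_basis (memvf u).
have tE (i : 'I_n) : [tuple v i | i < n]`_i = v i by rewrite -tnth_nth tnth_mktuple.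
rewrite {1}uE; apply: eq_bigr => i _; rewrite tE; congr (_ *: _).
rewrite [in RHS]uE linear_sum (bigD1 i) //= tE linearZ /= f_dual eqxx.
rewrite [X in _ + X]big1 => [|j /negbTE ji]; first by rewrite addr0; exact/esym/mulr1.
by rewrite tE linearZ /= f_dual eq_sym ji scaler0.
Qed.

Lemma linear_basis_ext (W : lmodType k) (g h : V -> W) :
  linear g -> linear h -> (forall i, g (v i) = h (v i)) -> g =1 h.
Proof.
move=> lg lh gh u; rewrite (dual_basis_expand u) (lin_sum lg) (lin_sum lh).
by apply: eq_bigr => i _; rewrite (linZ lg) (linZ lh) gh.
Qed.

Definition diag_op (c : 'I_n -> k) (u : V) : V := \sum_i (c i * f i u) *: v i.

Lemma diag_op_linear c : linear (diag_op c).
Proof.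
move=> e u w; rewrite /diag_op scaler_sumr -big_split; apply: eq_bigr => i _ /=.
by rewrite linearP mulrDr scalerDl scalerA; congr (_ *: _ + _); exact: mulrCA.
Qed.

Lemma diag_op_basis c j : diag_op c (v j) = c j *: v j.
Proof.
rewrite /diag_op (bigD1 j) //= f_dual eqxx mulr1 big1 ?addr0 // => i /negbTE ij.
by rewrite f_dual ij mulr0 scale0r.
Qed.

Lemma uact_linear (X : U) : linear (uact X : V -> V).
Proof. exact: (uact_bilin V).2. Qed.

(** Evaluated at [X], the sum over the dual bases composes the two actions and
    leaves [f_m(S(X_1) X_2 u)]. *)
Lemma dual_mcoef_sum m u :
  \sum_i dual_mcoef (f m) (v i) * mcoef (f i) u = (f m u : k) *: (1 : dual U).
Proof.
apply: dualP => X.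
have [s sE] := sweedler X.
have bS := antipode_mul_bilin U.
transitivity (\sum_i \sum_(p <- s)
   f m (uact (antipode p.1) (v i)) * f i (uact p.2 u) : k^o).
  rewrite dual_sumE.
  apply: eq_bigr => i _; rewrite dual_mulE.
  by rewrite sE //; exact: dual_tensor_bilin.
rewrite exchange_big /= -[RHS]/((f m u : k) * (counit X : k)).
transitivity (f m (uact (tlift (fun a b => antipode a * b) (comul X)) u)).
  rewrite sE // (lin_sum (g := fun Y => uact Y u)); last exact: (uact_bilin V).1.
  rewrite linear_sum; apply: eq_bigr => p _ /=.
  rewrite uactM [in RHS](dual_basis_expand (uact p.2 u)).
  rewrite (lin_sum (@uact_linear _)) linear_sum; apply: eq_bigr => i _.
  by rewrite (linZ (@uact_linear _)) linearZ; exact: mulrC.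
rewrite antipodel (linZ ((uact_bilin V).1 u)) uact1 linearZ; exact: mulrC.
Qed.

(** Evaluated at [X], the left side is [f_m(S(X_2) A X_1 u)] for the diagonal
    operator [A]; moving [A] to the right turns [S(X_2) A X_1] into
    [S(X_2) S(S(X_1)) A = S(S(X_1) X_2) A]. *)
Lemma mcoef_dual_sum m u c :
  (forall X w, diag_op c (uact X w) = uact (antipode (antipode X)) (diag_op c w)) ->
  \sum_i mcoef (f i) u * (c i *: dual_mcoef (f m) (v i)) =
  (f m (diag_op c u) : k) *: (1 : dual U).
Proof.
move=> cS; apply: dualP => X.
have [s sE] := sweedler X.
have bS := antipode_mul_bilin U.
transitivity (\sum_i \sum_(p <- s)
   f i (uact p.1 u) * (c i * f m (uact (antipode p.2) (v i))) : k^o).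
  rewrite dual_sumE.
  apply: eq_bigr => i _; rewrite dual_mulE.
  by rewrite sE //; exact: (dual_tensor_bilin (mcoef (f i) u) (c i *: dual_mcoef (f m) (v i))).
rewrite exchange_big /= -[RHS]/((f m (diag_op c u) : k) * (counit X : k)).
transitivity (f m (uact (antipode (tlift (fun a b => antipode a * b) (comul X)))
    (diag_op c u))).
  rewrite sE // linear_sum (lin_sum (g := fun Y => uact Y _)); last exact: (uact_bilin V).1.
  rewrite linear_sum; apply: eq_bigr => p _ /=.
  rewrite antipodeM uactM -cS /diag_op (lin_sum (@uact_linear _)) linear_sum.
  apply: eq_bigr => i _; rewrite (linZ (@uact_linear _)) linearZ.
  by rewrite mulrCA mulrA.
rewrite antipodel linearZ /= antipode1 (linZ ((uact_bilin V).1 _)) uact1 linearZ.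
exact: mulrC.
Qed.
End Coefficients.

(** * The square of the antipode on a weight module *)

Section QuantumGroup.
Variables (k : fieldType) (D : cartan_datum) (q : k) (U : qgroup D q).

Let rel := qg_rel U.

Lemma antipode_gK i : antipode (gK U i) = gK' U i.
Proof.
have bS := antipode_mul_bilin U.
have := antipodel (gK U i); rewrite comul_gK (tliftE bS) counit_gK scale1r => SK.
by rewrite -[LHS]mulr1 -(rel_KK' rel i) mulrA SK mul1r.
Qed.

Lemma antipode_gK' i : antipode (gK' U i) = gK U i.
Proof.
have := antipodeM (gK' U i) (gK U i).
rewrite (rel_K'K rel) antipode1 antipode_gK => SK.
by rewrite -[RHS]mulr1 SK mulrA (rel_KK' rel) mul1r.
Qed.

Lemma antipode_gE i : antipode (gE U i) = - (gE U i * gK' U i).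
Proof.
have bS := antipode_mul_bilin U.
have := antipodel (gE U i).
rewrite comul_gE (linD (tlift_linear bS)) !(tliftE bS) counit_gE scale0r.
rewrite antipode1 mul1r => /eqP; rewrite addr_eq0 => /eqP SE.
by rewrite -[LHS]mulr1 -(rel_KK' rel i) mulrA SE mulNr.
Qed.

Lemma antipode_gF i : antipode (gF U i) = - (gK U i * gF U i).
Proof.
have bS := antipode_mul_bilin U.
have := antipodel (gF U i).
rewrite comul_gF (linD (tlift_linear bS)) !(tliftE bS) counit_gF scale0r.
by rewrite antipode_gK' mulr1 => /eqP; rewrite addr_eq0 => /eqP.
Qed.

Lemma antipode2_gE i :
  antipode (antipode (gE U i)) = (qi q i ^+ 2) *: gE U i.
Proof.
rewrite antipode_gE linearN antipodeM antipode_gE antipode_gK' mulrN opprK mulrA.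
by rewrite (rel_KE rel) cart_diag -scalerAl -mulrA (rel_KK' rel) mulr1.
Qed.

Lemma antipode2_gF i :
  antipode (antipode (gF U i)) = (qi q i ^- 2) *: gF U i.
Proof.
rewrite antipode_gF linearN antipodeM antipode_gF antipode_gK mulNr opprK.
by rewrite (rel_KF rel) cart_diag -scalerAl -mulrA (rel_KK' rel) mulr1.
Qed.

(** Since [S^2] is multiplicative it is enough to intertwine on the generators,
    where [S^2] only rescales; [K_i^-1] is handled by cancelling [K_i]. *)
Lemma antipode2_intertwiner (V : umod U) (A : V -> V) : linear A ->
  (forall i w, A (uact (gK U i) w) = uact (gK U i) (A w)) ->
  (forall i w, A (uact (gE U i) w) = (qi q i ^+ 2) *: uact (gE U i) (A w)) ->
  (forall i w, A (uact (gF U i) w) = (qi q i ^- 2) *: uact (gF U i) (A w)) ->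
  forall X w, A (uact X w) = uact (antipode (antipode X)) (A w).
Proof.
move=> lA AK AE AF X.
elim: (qg_gen X) => {X}[X [i [] ->] w||c X Y _ IX _ IY w|X Y _ IX _ IY w].
- by rewrite antipode2_gE (linZ ((uact_bilin V).1 _)).
- by rewrite antipode2_gF (linZ ((uact_bilin V).1 _)).
- by rewrite antipode_gK antipode_gK'.
- rewrite antipode_gK' antipode_gK -[LHS]uact1 -(rel_K'K rel i) uactM -AK.
  by rewrite -uactM (rel_KK' rel) uact1.
- by move=> w; rewrite !antipode1 !uact1.
- by rewrite (uact_bilin V).1 lA IX IY !linearP (uact_bilin V).1.
by rewrite uactM IX IY !antipodeM uactM.
Qed.

Section Weights.
Variables (V : umod U) (n : nat) (v : 'I_n -> V) (f : 'I_n -> {linear V -> k^o}).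
Hypothesis v_basis : basis_of {:V}%VS [tuple v i | i < n].
Hypothesis f_dual : forall i j, f i (v j) = (i == j)%:R.
Variable mu : 'I_n -> 'I_D -> int.
Hypothesis v_weight :
  forall j i, uact (gK U i) (v j) = q ^ ((symz i)%:Z * mu j i) *: v j.
Hypothesis q_neq0 : q != 0.
Hypothesis q_generic : forall m : int, q ^ m = 1 -> m = 0.

Lemma dual_weight j i u :
  f j (uact (gK U i) u) = q ^ ((symz i)%:Z * mu j i) * f j u.
Proof.
move: u; apply: (linear_basis_ext v_basis f_dual) => [c a b|c a b|m].
- by rewrite (@uact_linear _ _ V) linearP.
- by rewrite linearP mulrDr; congr (_ + _); exact: mulrCA.
rewrite v_weight linearZ /= f_dual; case: eqP => [->|_] //.
by rewrite scaler0 mulr0.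
Qed.

(** A vector [X v_j] has eigenvalues [q_i ^ e_i q_i ^ (mu_j i)] under the [K_i];
    a nonzero component on [v_m] forces them to be those of [v_m], and [q] being
    generic the exponents agree. *)
Lemma weight_shift X (e : 'I_D -> int) j m :
  (forall i, gK U i * X = (qi q i ^ e i) *: (X * gK U i)) ->
  f m (uact X (v j)) != 0 -> forall i, mu m i = mu j i + e i.
Proof.
move=> KX fX0 i.
have : f m (uact (gK U i) (uact X (v j))) =
    (qi q i ^ e i * q ^ ((symz i)%:Z * mu j i)) * f m (uact X (v j)).
  rewrite -uactM KX (linZ ((uact_bilin V).1 _)) uactM v_weight.
  by rewrite (linZ (@uact_linear _ _ V _)) !linearZ; exact: mulrA.
rewrite dual_weight => /(mulIf fX0) /eqP.
rewrite /qi exprnP exprz_exp -expfzDr // => /eqP qe.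
have : q ^ ((symz i)%:Z * (mu m i - (mu j i + e i))) = 1.
  rewrite mulrBr mulrDr [X in _ - X]addrC expfzDr // qe.
  by rewrite -expfzDr // subrr expr0z.
move/q_generic/eqP; rewrite mulf_eq0 subr_eq0 => /orP[|/eqP //].
by rewrite eqz_nat eqn0Ngt symz_gt0.
Qed.
End Weights.
End QuantumGroup.

(** [sum_i (M_i / d) alpha_i] is [rho], characterised by its pairings with the
    simple roots.  Positive definiteness makes the Gram matrix [G] nonsingular, and
    its adjugate solves the system over the integers with [d = |det G|], the sign
    of the determinant being absorbed in [M]. *)
Lemma rho_coords (D : cartan_datum) : exists (M : 'I_D -> int) (d : nat),
  (0 < d)%N /\
  forall l, \sum_i M i * ((symz i)%:Z * cart i l) = d%:Z * (symz l)%:Z.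
Proof.
pose G : 'M[int]_D := \matrix_(i, l) ((symz i)%:Z * cart i l).
pose s : 'rV[int]_D := \row_l (symz l)%:Z.
have detG : \det G != 0.
  have : \det (map_mx intr G : 'M[rat]_D) != 0.
    apply/negP => /det0P[u u0 uG].
    have /existsP uN0 : [exists i, u 0 i != 0].
      apply: contraNT u0 => /existsPn u0; apply/eqP/rowP => i.
      by rewrite mxE; apply/eqP; have := u0 i; rewrite negbK.
    have := @cart_posdef D (fun i => u 0 i) uN0.
    rewrite exchange_big big1 ?ltxx //= => l _; rewrite -mulr_suml.
    have := congr1 (fun w : 'rV_D => w 0 l) uG; rewrite !mxE => uGl.
    rewrite [X in X * _](_ : _ = 0) ?mul0r //.
    by apply: etrans uGl; apply: eq_bigr => i _; rewrite !mxE mulrC.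
  by rewrite det_map_mx intr_eq0.
exists (fun i => sgz (\det G) * (s *m \adj G) 0 i), `|\det G|%N.
split=> [|l]; first by rewrite absz_gt0.
have := congr1 (fun w : 'rV_D => w 0 l) (mulmxA s (\adj G) G).
rewrite mul_adj_mx mul_mx_scalar !mxE => sG.
rewrite abszEsg -mulrA sG mulr_sumr.
by apply: eq_bigr => i _; rewrite -mulrA [G i l]mxE.
Qed.

(** A substitute for [K_(2 rho)], which multiplies a vector of weight [mu] by
    [q ^ (2 rho, mu)].  Here the factor is [Q ^ (d (rho, mu))] with [Q ^ d = q ^ 2]; its
    exponent is an integer, and when [mu] moves by a root [beta] it changes by the
    same ratio [q ^ (2 rho, beta)], which is all that the intertwining uses. *)
Lemma twist_exists (C : numClosedFieldType) (D : cartan_datum) (q : C)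
    (U : qgroup D q) (V : umod U) (n : nat)
    (v : 'I_n -> V) (f : 'I_n -> {linear V -> C^o}) :
  q != 0 -> (forall m : int, q ^ m = 1 -> m = 0) ->
  weight_basis v -> dual_basis v f ->
  exists c : 'I_n -> C, (forall j, c j != 0) /\
    forall X w, diag_op v f c (uact X w) =
      uact (antipode (antipode X)) (diag_op v f c w).
Proof.
move=> q0 q_gen [v_basis /fin_all_exists[mu v_wt]] f_dual.
have [M [d [d0 Mrho]]] := rho_coords D.
pose Q := d.-root (q ^+ 2).
have Qd : Q ^+ d = q ^+ 2 by exact: rootCK.
have Q0 : Q != 0.
  apply: contraNneq q0 => Q0; move: Qd.
  by rewrite Q0 expr0n eqn0Ngt d0 => /esym/eqP; rewrite expf_eq0.
have Qrho l : Q ^ (\sum_i M i * ((symz i)%:Z * cart i l)) = qi q l ^+ 2.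
  rewrite Mrho -PoszM -exprnP exprM Qd /qi -!exprM mulnC //.
pose c j := Q ^ (\sum_i M i * ((symz i)%:Z * mu j i)).
exists c; split=> [j|]; first exact: expfz_neq0.
have lA := diag_op_linear v f c.
have shift X (e : 'I_D -> int) w :
    (forall i, gK U i * X = (qi q i ^ e i) *: (X * gK U i)) ->
    diag_op v f c (uact X w) =
      (Q ^ (\sum_i M i * ((symz i)%:Z * e i))) *: uact X (diag_op v f c w).
  move=> KX; move: w; apply: (linear_basis_ext v_basis f_dual) => [a b w|a b w|j].
  - by rewrite (uact_linear X) lA.
  - by rewrite lA (uact_linear X) scalerDr !scalerA mulrC.
  rewrite (diag_op_basis f_dual) (linZ (uact_linear X)) scalerA.
  rewrite [in RHS](dual_basis_expand v_basis f_dual (uact X (v j))) scaler_sumr.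
  apply: eq_bigr => m _; rewrite scalerA; congr (_ *: _).
  have [->|fX] := eqVneq (f m (uact X (v j))) 0; first by rewrite !mulr0.
  congr (_ * _); rewrite /c -expfzDr // -big_split /=; congr (_ ^ _).
  apply: eq_bigr => i _.
  rewrite (weight_shift v_basis f_dual v_wt q0 q_gen KX fX).
  by rewrite -mulrDr -mulrDr addrC.
have rel := qg_rel U.
apply: antipode2_intertwiner => // [i w|i w|i w].
- rewrite (@shift _ (fun=> 0)); last by move=> l; rewrite expr0z scale1r (rel_KK rel).
  by rewrite big1 ?expr0z ?scale1r // => l _; rewrite !mulr0.
- by rewrite (@shift _ (fun l => cart l i)) ?Qrho // => l; apply: (rel_KE rel).
rewrite (@shift _ (fun l => - cart l i)); last by move=> l; apply: (rel_KF rel).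
rewrite (eq_bigr (fun l => - (M l * ((symz l)%:Z * cart l i)))); last first.
  by move=> l _; rewrite !mulrN.
by rewrite sumrN -invr_expz Qrho.
Qed.

Lemma real_not_root_of_unity (R : realType) (q : R) :
  q != -1 -> q != 0 -> q != 1 -> forall m : int, (q%:C : R[i]) ^ m = 1 -> m = 0.
Proof.
move=> qN1 q0 q1 m; rewrite -(fmorphXz (@real_complex R)) => qm.
have {}qm : q ^ m = 1 by apply: (fmorph_inj (@real_complex R)); rewrite qm rmorph1.
have aq0 : 0 < `|q| by rewrite normr_gt0.
have aq1 : `|q| != 1 by rewrite eqr_norml negb_and negb_or q1 qN1.
apply: (ieexprIz aq0 aq1).
have normXz : `|q ^ m| = `|q| ^ m by case: (m) => n; rewrite /exprz ?normfV normrX.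
by rewrite expr0z -normXz qm normr1.
Qed.

(** * The zero connection *)

Theorem proposition5p8 (R : realType) (q : R)
  (q_neqN1 : q != -1) (q_neq0 : q != 0) (q_neq1 : q != 1)
  (* the irreducible quantum flag manifold, S = Pi \ {alpha_x} *)
  (D : cartan_datum) (U : qgroup D (q%:C : R[i])) (x : 'I_D)
  (x_comin : cominuscule x)
  (P := OqGLs U [set~ x]%SET : set (dual U))
  (B := OqGL U [set~ x]%SET : set (dual U))
  (* the generators z_i and zbar_j; the last basis vector has highest weight *)
  (V : umod U) (N : nat) (v : 'I_N.+1 -> V) (f : 'I_N.+1 -> {linear V -> R[i]^o})
  (V_hw : hw_module V (fund_weight x) (v ord_max))
  (v_basis : weight_basis v) (f_dual : dual_basis v f)
  (z := fun i => mcoef (f i) (v ord_max) : dual U)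
  (zbar := fun j => dual_mcoef (f ord_max) (v j) : dual U)
  (* the O(U_1)-coaction on P *)
  (deg : int -> set (dual U)) (deg_grading : Zgrading P deg)
  (deg_z : forall i, deg 1 (z i)) (deg_zbar : forall j, deg (-1) (zbar j))
  (deg0 : deg 0 = B)
  (* the (0,1)-calculus over P *)
  (Om : fodc P)
  (dL : {linear Om -> tens (dual U) Om}) (dL_cov : left_covariance (Oq U) dL)
  (d_holo : forall g, subalg_gen (range z) g -> fdiff Om g = 0)
  (phi : {linear Om -> tens (dual U) (lquot (I01 U x))})
  (phi_iso : restr_iso01 phi)
  (dR : {linear Om -> tens Om (OU1 R[i])}) (dR_cov : right_covariance deg dR) :
  let Pi0 : {linear Om -> Om} := \0 in
  [/\ principal_connection B dR Pi0, strong_connection B Pi0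
    & left_covariant_map dL Pi0].
Proof.
have q0 : (q%:C : R[i]) != 0 by rewrite fmorph_eq0.
have [c [c0 cS]] := twist_exists q0
  (real_not_root_of_unity q_neqN1 q_neq0 q_neq1) v_basis f_dual.
have zbar_z : \sum_i zbar i * z i = 1.
  rewrite (dual_mcoef_sum v_basis.1 f_dual) f_dual eqxx; exact: scale1r.
(* the highest weight entry of the operator normalises the relation to 1 *)
pose c' i := (c ord_max)^-1 * c i.
have z_zbar : \sum_i z i * (c' i *: zbar i) = 1.
  transitivity ((c ord_max)^-1 *: \sum_i z i * (c i *: zbar i)).
    rewrite scaler_sumr; apply: eq_bigr => i _.
    by rewrite -!scalerAr scalerA.
  have fN : f ord_max (c ord_max *: v ord_max) = c ord_max.
    by rewrite linearZ f_dual eqxx; exact: mulr1.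
  rewrite (mcoef_dual_sum _ _ cS) (diag_op_basis f_dual) fN scalerA.
  by rewrite mulVf // scale1r.
have dz i : fdiff Om (z i) = 0 by apply: d_holo; apply: subalg_mem; exists i.
have zbar'_deg i : deg (-1) (c' i *: zbar i).
  rewrite -[_ *: _]addr0; apply: (deg_lin deg_grading) (deg_zbar i) _.
  exact: deg_zero deg_grading _.
have frame_pos : flat_frame Om deg 1 [seq (zbar i, z i) | i : 'I_N.+1].
  split; first by move=> _ /mapP[i _ ->]; split; [exact: deg_zbar|exact: deg_z].
    by rewrite big_map big_enum.
  rewrite big_map; apply: big1 => i _ /=.
  by rewrite dz (lin0 (flact_linr (deg_sub deg_grading (deg_zbar i)))).
have frame_neg : flat_frame Om deg (-1) [seq (z i, c' i *: zbar i) | i : 'I_N.+1].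
  split; first by move=> _ /mapP[i _ ->]; rewrite opprK; split; [exact: deg_z|exact: zbar'_deg].
    by rewrite big_map big_enum.
  (* d 1 = sum_i d(z_i y_i), and each d(z_i) vanishes *)
  rewrite big_map big_enum /= -[RHS](diff1 Om deg_grading) -z_zbar.
  have z_zbar_deg i : deg 0 (z i * (c' i *: zbar i)).
    by have := deg_mul deg_grading (deg_z i) (zbar'_deg i); rewrite subrr.
  rewrite (diff_sum Om deg_grading (n := 0)) => [|i _]; last exact: z_zbar_deg.
  apply: eq_bigr => i _.
  have Pz := deg_sub deg_grading (deg_z i).
  have Pzb := deg_sub deg_grading (zbar'_deg i).
  by rewrite fdiffM // dz (lin0 (fract_linl Pzb)) add0r.
have dP := diff_in_r_ideal deg_grading deg0 frame_pos frame_neg.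
move=> Pi0; have Pi0E w : Pi0 w = 0 by [].
split; last 1 first.
- by move=> w; rewrite Pi0E linear0 tmap0 //; right.
- split=> [p w Pp|w|w|].
  + by rewrite !Pi0E (lin0 (flact_linr Pp)).
  + by rewrite Pi0E linear0 tmap0 //; left.
  + by rewrite Pi0E.
  by rewrite (lr_ideal_setT dP); apply/seteqP; split.
by move=> p Pp; rewrite Pi0E subr0; apply: dP.
Qed.
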